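(* Let $\tau_0=i/\sqrt3$. Then $$\phi(\tau_0)=\frac{\sqrt3}{2\pi}\cdot\frac{1}{2^{1/3}}\,B(1/3,1/3)\qquad\text{and}\qquad \phi_1(\tau_0)=\frac{1}{2^{2/3}\cdot3^{1/2}}\cdot\frac{1}{2\pi}\,B(1/3,1/3).$$
   Context: Let $q^r=e^{2\pi ir\tau}$ for $\tau$ in the upper half-plane. $\theta_2(\tau)=\sum_{n\in\mathbb{Z}}q^{(2n+1)^2/8}$ and $\theta_3(\tau)=\sum_{n\in\mathbb{Z}}q^{n^2/2}$. Define $\phi(\tau)=\theta_2(2\tau)\theta_2(6\tau)+\theta_3(2\tau)\theta_3(6\tau)$ and $\phi_1(\tau)=\frac16\big(\phi(\tau/3)-\phi(\tau)\big)$. $B(a,b)=\Gamma(a)\Gamma(b)/\Gamma(a+b)$ is the beta function. *)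

(* Defs.v *)
From Stdlib Require Import Reals ZArith.
From Coquelicot Require Import Coquelicot.

Open Scope R_scope.

Definition cexp (z : C) : C :=
  (exp (Re z) * cos (Im z), exp (Re z) * sin (Im z)).

Definition qpow (r : R) (tau : C) : C :=
  cexp (Cmult (Cmult (RtoC (2 * PI * r)) Ci) tau).

Definition CSeries (f : nat -> C) : C :=
  (Series (fun n => Re (f n)), Series (fun n => Im (f n))).

Definition ZSeries (f : Z -> C) : C :=
  Cplus (CSeries (fun n => f (Z.of_nat n)))
        (CSeries (fun n => f (- Z.of_nat (S n))%Z)).

Definition theta2 (tau : C) : C :=
  ZSeries (fun n => qpow (IZR ((2 * n + 1) ^ 2) / 8) tau).
Definition theta3 (tau : C) : C :=
  ZSeries (fun n => qpow (IZR (n ^ 2) / 2) tau).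

Definition phi (tau : C) : C :=
  Cplus (Cmult (theta2 (Cmult (RtoC 2) tau)) (theta2 (Cmult (RtoC 6) tau)))
        (Cmult (theta3 (Cmult (RtoC 2) tau)) (theta3 (Cmult (RtoC 6) tau))).

Definition phi1 (tau : C) : C :=
  Cmult (RtoC (1 / 6)) (Cminus (phi (Cdiv tau (RtoC 3))) (phi tau)).

Definition Gamma (s : R) : R :=
  RInt_gen (fun t => Rpower t (s - 1) * exp (- t)) (at_right 0) (Rbar_locally p_infty).

Definition Beta (a b : R) : R := Gamma a * Gamma b / Gamma (a + b).

Definition tau0 : C := (0, 1 / sqrt 3).

(* Main.v *)
(** Write [a(s)] for the theta series [sum e^{-s N(z)}] of the Eisenstein integers and [c(s)]
    for the sum of [e^{-s N(z)/3}] over the coset [1 + pi Z[omega]], [pi = sqrt(-3)]; then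
    [phi(i y) = a(2 pi y)] and [phi_1 = c / 3].  A discrete Fourier transform over [Z[omega]]
    applied to [c^3] gives the cubic identity [a^3 = b^3 + c^3] of Borwein, Borwein and Garvan,
    with [b(s) = a(3s) - c(3s)].  Hence [s -> 3s] acts on the modulus [z = (c/a)^3] exactly as the
    cubic transformation of [F = 2F1(1/3,2/3;1;-)], and iterating it gives [a = F(z)], while
    [F(1-z)/F(z)] is multiplied by 3.  Since [F(1-z) ~ -(sqrt 3/(2 pi)) ln z] at [0] and
    [ln z ~ -s], this ratio is [sqrt 3 s/(2 pi)]; at [s = 2 pi/sqrt 3] it is 1, so [z = 1/2],
    [a = F(1/2)] and [c = a / 2^(1/3)].
    Finally [F(z) + F(1-z) = 2 F(1/2) 2F1(1/6,1/3;1/2;(1-2z)^2)], and comparing the logarithmic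
    singularities at [z = 0] expresses [F(1/2)] by Gamma values. *)

Require Import Defs.
From Stdlib Require Import Reals ZArith.
From Coquelicot Require Import Coquelicot.
From Stdlib Require Import List Lra Lia Classical ClassicalEpsilon.
Import ListNotations.
Open Scope R_scope.

(** * Unordered sums of nonnegative families *)

(** No modular inversion formula is used: the relation between $F(1-z)$ and $s\,a$ is read off from
    the behaviour at the cusp, by following $s, 3s, 9s, \dots$ until only the logarithm of $F(1-z)$
    is visible. On the imaginary axis all theta terms are positive, so the lattice identities become
    bijections between index sets of suprema of finite sums. Two obstacles shape the rest. The
    transformation of $F$ compares solutions at a singular point of their equation, where initial
    values do not determine a solution; a Wronskian weighted by the vanishing leading coefficient
    does. And the power series are only used inside the unit disc, so $b/a$ must be known to lie in
    $(0,1)$; crude bounds give this for $s \ge 69/20$, a range that still contains $2\pi/\sqrt3$.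
    The two transcendental constants come from coefficient asymptotics: $\pi$ enters through
    $\sin(\pi/3)$ in Wallis-type integrals, and the Gamma values through Gauss's product, obtained
    from the integral by the substitution $t = w^3$. *)

Definition lsum {T : Type} (f : T -> R) (l : list T) : R :=
  fold_right (fun x acc => f x + acc) 0 l.

(** Lists without repetition stand for finite subsets, and the value is the supremum of the finite
    subsums. For nonnegative families this is the unconditional sum, so that reindexing along a
    bijection needs no convergence argument. *)
Definition is_usum {T : Type} (f : T -> R) (s : R) : Prop :=
  (forall l, NoDup l -> lsum f l <= s) /\
  (forall K, (forall l, NoDup l -> lsum f l <= K) -> s <= K).

Lemma lsum_app {T} (f : T -> R) l1 l2 : lsum f (l1 ++ l2) = lsum f l1 + lsum f l2.
Proof. induction l1 as [|x l IH]; simpl; [ring|]. rewrite IH. ring. Qed.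

Lemma lsum_map {T U} (g : U -> T) (f : T -> R) l :
  lsum f (map g l) = lsum (fun x => f (g x)) l.
Proof. induction l as [|x l IH]; simpl; [easy|]. now rewrite IH. Qed.

Lemma lsum_ext {T} (f g : T -> R) l : (forall x, f x = g x) -> lsum f l = lsum g l.
Proof. intros H. induction l as [|x l IH]; simpl; [easy|]. now rewrite IH, H. Qed.

Lemma lsum_le {T} (f g : T -> R) l : (forall x, f x <= g x) -> lsum f l <= lsum g l.
Proof. intros H. induction l as [|x l IH]; simpl; [lra|]. specialize (H x). lra. Qed.

Lemma lsum_scal {T} (f : T -> R) c l : lsum (fun x => c * f x) l = c * lsum f l.
Proof. induction l as [|x l IH]; simpl; [ring|]. rewrite IH. ring. Qed.

Lemma lsum_incl {T} (f : T -> R) l1 l2 :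
  (forall x, 0 <= f x) -> NoDup l1 -> incl l1 l2 -> lsum f l1 <= lsum f l2.
Proof.
intros Hf Hn. revert l2. induction Hn as [|x l Hx Hn IH]; intros l2 Hi; simpl.
- clear Hi. induction l2 as [|y l2 IH]; simpl; [lra|]. specialize (Hf y). lra.
- destruct (in_split x l2) as [m1 [m2 ->]]; [apply Hi; now left|].
  specialize (IH (m1 ++ m2)). rewrite lsum_app in *. simpl.
  enough (lsum f l <= lsum f m1 + lsum f m2) by lra. apply IH.
  intros y Hy. specialize (Hi y (or_intror Hy)).
  apply in_app_or in Hi. apply in_or_app. destruct Hi as [H|[H|H]]; auto. congruence.
Qed.

Lemma lsum_list_prod {T U} (f : T -> R) (g : U -> R) l1 l2 :
  lsum (fun p => f (fst p) * g (snd p)) (list_prod l1 l2) = lsum f l1 * lsum g l2.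
Proof.
induction l1 as [|x l IH]; simpl; [ring|].
rewrite lsum_app, IH, lsum_map. simpl. rewrite lsum_scal. ring.
Qed.

Lemma is_usum_ext {T} (f g : T -> R) s : (forall x, f x = g x) -> is_usum f s -> is_usum g s.
Proof.
intros H [H1 H2]. split.
- intros l Hl. rewrite <- (lsum_ext f g); auto.
- intros K HK. apply H2. intros l Hl. rewrite (lsum_ext f g); auto.
Qed.

Lemma is_usum_unique {T} (f : T -> R) s t : is_usum f s -> is_usum f t -> s = t.
Proof. intros [H1 H2] [H3 H4]. apply Rle_antisym; auto. Qed.

Lemma is_usum_scal {T} (f : T -> R) c s :
  0 < c -> is_usum f s -> is_usum (fun x => c * f x) (c * s).
Proof.
intros Hc [H1 H2]. split.
- intros l Hl. rewrite lsum_scal. apply Rmult_le_compat_l; [lra|auto].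
- intros K HK. enough (s <= / c * K).
  { apply (Rmult_le_compat_l c) in H; [|lra].
    rewrite <- Rmult_assoc, Rinv_r in H; lra. }
  apply H2. intros l Hl. specialize (HK l Hl). rewrite lsum_scal in HK.
  apply (Rmult_le_reg_l c); [lra|]. rewrite <- Rmult_assoc, Rinv_r; lra.
Qed.

Lemma is_usum_term {T} (f : T -> R) s x : is_usum f s -> f x <= s.
Proof.
intros [H _]. specialize (H [x]). simpl in H. rewrite Rplus_0_r in H.
apply H. constructor; [easy|constructor].
Qed.

Lemma NoDup_map_inj {T U} (g : U -> T) l :
  (forall x y, g x = g y -> x = y) -> NoDup l -> NoDup (map g l).
Proof.
intros Hg Hl. induction Hl as [|x l Hx Hl IH]; simpl; constructor; auto.
intros H. apply in_map_iff in H. destruct H as [y [Hy Hin]]. apply Hg in Hy. congruence.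
Qed.

Lemma is_usum_bij {T U} (g : U -> T) (f : T -> R) s :
  (forall x y, g x = g y -> x = y) -> (forall t, exists u, g u = t) ->
  is_usum (fun u => f (g u)) s <-> is_usum f s.
Proof.
intros Hi Hs.
assert (Hl : forall l, NoDup l -> exists l', NoDup l' /\ l = map g l').
{ intros l Hl.
  assert (He : exists l', l = map g l').
  { clear Hl. induction l as [|x l [l' ->]]; [now exists []|].
    destruct (Hs x) as [u <-]. now exists (u :: l'). }
  destruct He as [l' ->]. exists l'. split; [|easy].
  now apply NoDup_map_inv in Hl. }
split; intros [H1 H2]; split.
- intros l Hn. destruct (Hl l Hn) as [l' [Hn' ->]]. rewrite lsum_map. auto.
- intros K HK. apply H2. intros l Hn. rewrite <- (lsum_map g f).
  apply HK. now apply NoDup_map_inj.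
- intros l Hn. rewrite <- (lsum_map g f). apply H1. now apply NoDup_map_inj.
- intros K HK. apply H2. intros l Hn. destruct (Hl l Hn) as [l' [Hn' ->]].
  rewrite lsum_map. auto.
Qed.

Lemma is_usum_bound {T} (f : T -> R) K :
  (forall l, NoDup l -> lsum f l <= K) -> exists s, is_usum f s /\ s <= K.
Proof.
intros H.
destruct (completeness (fun x => exists l, NoDup l /\ x = lsum f l)) as [s [Hs1 Hs2]].
- exists K. intros x [l [Hl ->]]. auto.
- exists 0, []. split; [constructor|easy].
- exists s. split; [split|].
  + intros l Hl. apply Hs1. eauto.
  + intros K' HK'. apply Hs2. intros x [l [Hl ->]]. auto.
  + apply Hs2. intros x [l [Hl ->]]. auto.
Qed.

Lemma is_usum_dominated {T} (f g : T -> R) t :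
  (forall x, f x <= g x) -> is_usum g t -> exists s, is_usum f s /\ s <= t.
Proof.
intros Hfg [H _]. apply is_usum_bound. intros l Hl.
apply Rle_trans with (lsum g l); [now apply lsum_le|auto].
Qed.

Lemma is_usum_inj {T U} (g : U -> T) (f : T -> R) s :
  (forall x y, g x = g y -> x = y) -> is_usum f s ->
  exists t, is_usum (fun u => f (g u)) t /\ t <= s.
Proof.
intros Hi [H _]. apply is_usum_bound. intros l Hl.
rewrite <- (lsum_map g f). apply H. now apply NoDup_map_inj.
Qed.

Definition classic_eq_dec (T : Type) (x y : T) : {x = y} + {x <> y} :=
  excluded_middle_informative (x = y).

(** A finite set of pairs lies in the product of its two projections, which gives the upper bound.
    For the lower one, the supremum is taken over the second list with the first one fixed, then
    over the first; a zero factor is treated apart because each step divides by the other factor. *)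
Lemma is_usum_prod {T U} (f : T -> R) (g : U -> R) s t :
  (forall x, 0 <= f x) -> (forall y, 0 <= g y) -> is_usum f s -> is_usum g t ->
  is_usum (fun p => f (fst p) * g (snd p)) (s * t).
Proof.
intros Hf Hg [F1 F2] [G1 G2].
assert (Hs : 0 <= s) by (apply (F1 []); constructor).
assert (Pf : forall l, 0 <= lsum f l).
{ induction l as [|x l IH]; simpl; [lra|]. specialize (Hf x). lra. }
assert (Pg : forall l, 0 <= lsum g l).
{ induction l as [|x l IH]; simpl; [lra|]. specialize (Hg x). lra. }
split.
- intros l Hl.
  set (l1 := nodup (classic_eq_dec T) (map fst l)). set (l2 := nodup (classic_eq_dec U) (map snd l)).
  apply Rle_trans with (lsum (fun p => f (fst p) * g (snd p)) (list_prod l1 l2)).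
  + apply lsum_incl; auto.
    * intros p. now apply Rmult_le_pos.
    * intros [x y] Hxy. apply in_prod; apply nodup_In.
      -- now apply (in_map fst) in Hxy.
      -- now apply (in_map snd) in Hxy.
  + rewrite lsum_list_prod. apply Rmult_le_compat; auto.
    * apply F1, NoDup_nodup.
    * apply G1, NoDup_nodup.
- intros K HK.
  assert (H : forall l1, NoDup l1 -> lsum f l1 * t <= K).
  { intros l1 Hl1. destruct (Pf l1) as [Hp|Hp].
    - enough (t <= / lsum f l1 * K).
      { apply (Rmult_le_compat_l (lsum f l1)) in H; [|lra].
        rewrite <- Rmult_assoc, Rinv_r in H; lra. }
      apply G2. intros l2 Hl2. apply (Rmult_le_reg_l (lsum f l1)); [lra|].
      rewrite <- Rmult_assoc, Rinv_r, Rmult_1_l, <- lsum_list_prod by lra.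
      apply HK. clear - Hl1 Hl2.
      induction Hl1 as [|x l Hx Hl IH]; simpl; [constructor|].
      apply NoDup_app.
      + apply NoDup_map_inj; [|easy]. now intros a b [= ->].
      + easy.
      + intros [a b] Ha Hb. apply in_map_iff in Ha. destruct Ha as [y [[= <- <-] _]].
        apply in_prod_iff in Hb. easy.
    - rewrite <- Hp, Rmult_0_l. specialize (HK [] (NoDup_nil _)). easy. }
  assert (Ht : 0 <= t) by (apply (G1 []); constructor).
  destruct Ht as [Ht|Ht].
  + enough (s <= / t * K).
    { apply (Rmult_le_compat_l t) in H0; [|lra].
      rewrite <- Rmult_assoc, Rinv_r in H0; lra. }
    apply F2. intros l1 Hl1. specialize (H l1 Hl1).
    apply (Rmult_le_reg_l t); [lra|]. rewrite <- Rmult_assoc, Rinv_r; lra.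
  + rewrite <- Ht, Rmult_0_r. specialize (HK [] (NoDup_nil _)). easy.
Qed.

Lemma lsum_filter {T} (f : T -> R) (p : T -> bool) l :
  lsum f l = lsum f (filter p l) + lsum f (filter (fun x => negb (p x)) l).
Proof.
induction l as [|x l IH]; simpl; [ring|]. destruct (p x); simpl; rewrite IH; ring.
Qed.

(** Summation over a finite partition. Each decomposition of a lattice into classes below is a
    bijection from such a product followed by this lemma. *)
Lemma is_usum_fin {I T} (enum : list I) (f : I * T -> R) (s : I -> R) :
  NoDup enum -> (forall i, In i enum) ->
  (forall i, is_usum (fun x => f (i, x)) (s i)) ->
  is_usum f (lsum s enum).
Proof.
intros Hn Hfull Hs.
assert (Hu : forall m L, NoDup L -> (forall p, In p L -> In (fst p) m) ->
  lsum f L <= lsum s m).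
{ induction m as [|i m IH]; intros L HL Hin; simpl.
  - destruct L as [|p L]; simpl; [lra|]. destruct (Hin p (or_introl eq_refl)).
  - set (b := fun p : I * T => if classic_eq_dec I (fst p) i then true else false).
    rewrite (lsum_filter f b). apply Rplus_le_compat.
    + assert (E : filter b L = map (fun x => (i, x)) (map snd (filter b L))).
      { rewrite map_map. rewrite <- (map_id (filter b L)) at 1.
        apply map_ext_in. intros [j x] Hj. apply filter_In in Hj. unfold b in Hj. simpl in *.
        destruct (classic_eq_dec I j i); [now subst|easy]. }
      rewrite E, lsum_map. apply (Hs i).
      apply (NoDup_map_inv (fun x => (i, x))). rewrite <- E. now apply NoDup_filter.
    + apply IH; [now apply NoDup_filter|]. intros p Hp. apply filter_In in Hp.
      destruct Hp as [Hp Hb]. destruct (Hin p Hp) as [E|]; [|easy].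
      unfold b in Hb. destruct (classic_eq_dec I (fst p) i); [discriminate|congruence]. }
split.
- intros L HL. now apply Hu.
- assert (Hl : forall m, NoDup m -> forall K,
    (forall L, NoDup L -> (forall p, In p L -> In (fst p) m) -> lsum f L <= K) ->
    lsum s m <= K).
  { intros m Hm. induction Hm as [|i m Hi Hm IH]; intros K HK; simpl.
    - apply (HK []); [constructor|easy].
    - enough (lsum s m <= K - s i) by lra. apply IH. intros L HL HLm.
      enough (s i <= K - lsum f L) by lra. apply (Hs i). intros l Hl.
      specialize (HK (map (fun x => (i, x)) l ++ L)).
      rewrite lsum_app, lsum_map in HK. enough (lsum (fun x => f (i, x)) l + lsum f L <= K) by lra.
      apply HK.
      + apply NoDup_app; [|easy|].
        * apply NoDup_map_inj; [|easy]. now intros a b [= ->].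
        * intros p Hp Hp'. apply in_map_iff in Hp. destruct Hp as [x [<- _]].
          apply HLm in Hp'. easy.
      + intros p Hp. apply in_app_or in Hp. destruct Hp as [Hp|Hp].
        * apply in_map_iff in Hp. destruct Hp as [x [<- _]]. now left.
        * right. now apply HLm. }
  intros K HK. apply Hl; auto.
Qed.

Lemma lsum_seq (f : nat -> R) n : lsum f (seq 0 (S n)) = sum_n f n.
Proof.
induction n as [|n IH].
- simpl. rewrite sum_O. ring.
- rewrite seq_S, lsum_app, IH, sum_Sn. simpl. unfold plus; simpl. ring.
Qed.

Lemma incl_seq (l : list nat) : exists n, incl l (seq 0 (S n)).
Proof.
exists (list_max l). intros x Hx. apply in_seq. split; [lia|].
enough (x <= list_max l)%nat by lia.
pose proof (proj1 (list_max_le l (list_max l)) (le_n _)) as H.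
rewrite Forall_forall in H. auto.
Qed.

Lemma is_usum_Series (f : nat -> R) s :
  (forall n, 0 <= f n) -> is_usum f s -> Series f = s.
Proof.
intros Hf [H1 H2]. apply is_series_unique.
change (is_lim_seq (sum_n f) s). apply is_lim_seq_spec. intros eps.
destruct (classic (exists l, NoDup l /\ s - eps < lsum f l)) as [[l [Hl Hs]]|Hno].
- destruct (incl_seq l) as [n Hn]. exists n. intros m Hm.
  assert (lsum f l <= sum_n f m).
  { rewrite <- lsum_seq. apply lsum_incl; auto. intros x Hx. apply Hn in Hx.
    apply in_seq in Hx. apply in_seq. lia. }
  assert (sum_n f m <= s) by (rewrite <- lsum_seq; apply H1, seq_NoDup).
  apply Rabs_def1; lra.
- assert (s <= s - eps).
  { apply H2. intros l Hl. apply Rnot_lt_le. intros H. apply Hno. eauto. }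
  destruct eps as [e He]. simpl in *. lra.
Qed.

Lemma is_series_usum (f : nat -> R) s :
  (forall n, 0 <= f n) -> is_series f s -> is_usum f s.
Proof.
intros Hf Hs. destruct (is_usum_bound f s) as [t [Ht _]].
- intros l Hl. destruct (incl_seq l) as [n Hn].
  apply Rle_trans with (sum_n f n); [rewrite <- lsum_seq; now apply lsum_incl|].
  apply (is_lim_seq_incr_compare (sum_n f) s Hs).
  intros m. rewrite sum_Sn. unfold plus; simpl. specialize (Hf (S m)). lra.
- rewrite <- (is_series_unique _ _ Hs). now rewrite (is_usum_Series f t).
Qed.

Definition zmap (p : bool * nat) : Z :=
  if fst p then Z.of_nat (snd p) else (- Z.of_nat (S (snd p)))%Z.

Lemma is_usum_Z (f : Z -> R) s t :
  is_usum (fun n => f (Z.of_nat n)) s -> is_usum (fun n => f (- Z.of_nat (S n))%Z) t ->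
  is_usum f (s + t).
Proof.
intros Hs Ht. apply (is_usum_bij zmap).
- intros [[] x] [[] y]; unfold zmap; simpl fst; simpl snd; cbv iota; intros; f_equal; lia.
- intros z. destruct (Z_le_gt_dec 0 z).
  + exists (true, Z.to_nat z). unfold zmap; simpl. lia.
  + exists (false, Z.to_nat (- z - 1)). unfold zmap; cbv [fst snd]. lia.
- replace (s + t) with (lsum (fun b : bool => if b then s else t) [true; false])
    by (simpl; ring).
  apply is_usum_fin.
  + repeat constructor; simpl; intuition congruence.
  + intros []; simpl; auto.
  + intros []; unfold zmap; cbv [fst snd]; assumption.
Qed.

(** A total function chosen by description; its value means something only once some [is_usum] fact
    is available. *)
Definition usum {T} (f : T -> R) : R := epsilon (inhabits 0) (is_usum f).

Lemma usum_unique {T} (f : T -> R) s : is_usum f s -> usum f = s.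
Proof.
intros H. apply (is_usum_unique f); [|easy].
apply (epsilon_spec (inhabits 0) (is_usum f)). eauto.
Qed.

Lemma usum_correct {T} (f : T -> R) s : is_usum f s -> is_usum f (usum f).
Proof. intros H. now rewrite (usum_unique f s). Qed.

(** * Theta series of the Eisenstein integers *)

(** The pair $(x,y)$ stands for $x + y\omega$ with $\omega^2+\omega+1=0$. *)
Definition eis_norm (z : Z * Z) : Z :=
  (fst z * fst z - fst z * snd z + snd z * snd z)%Z.

Definition gauss (s : R) (z : Z * Z) : R := exp (- s * IZR (eis_norm z)).

(** The coordinates of $1 + \pi u$ with $\pi = 1 + 2\omega$, so $\pi^2 = -3$. *)
Definition pi_coset (u : Z * Z) : Z * Z :=
  (1 + fst u - 2 * snd u, 2 * fst u - snd u)%Z.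

Definition eis_theta (s : R) : R := usum (gauss s).
(** The exponent carries no factor $1/3$: the classical $c(s)$ is [eis_coset_theta (s / 3)]. *)
Definition eis_coset_theta (s : R) : R := usum (fun u => gauss s (pi_coset u)).

Lemma gauss_pos s z : 0 < gauss s z.
Proof. apply exp_pos. Qed.

Lemma gauss_scale k s z w :
  eis_norm z = (k * eis_norm w)%Z -> gauss (IZR k * s) w = gauss s z.
Proof. intros H. unfold gauss. rewrite H, mult_IZR. f_equal. ring. Qed.

Lemma gauss_eq s z w : eis_norm z = eis_norm w -> gauss s z = gauss s w.
Proof. intros H. unfold gauss. now rewrite H. Qed.

Lemma eis_norm_ge z : (fst z * fst z + snd z * snd z <= 2 * eis_norm z)%Z.
Proof. unfold eis_norm. pose proof (Z.square_nonneg (fst z - snd z)). lia. Qed.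

(** The value of $\sum_{n\in\mathbb Z} e^{-s|n|}$, the majorant of one coordinate. *)
Definition sq_bound (s : R) : R := (1 + exp (- s)) / (1 - exp (- s)).

Lemma is_series_exp_geom s : 0 < s -> is_series (fun n => exp (- s) ^ n) (/ (1 - exp (- s))).
Proof.
intros Hs. apply is_series_geom. rewrite Rabs_pos_eq by (left; apply exp_pos).
rewrite <- exp_0. apply exp_increasing. lra.
Qed.

Lemma exp_pow x n : exp x ^ n = exp (INR n * x).
Proof.
induction n as [|n IH]; [simpl; now rewrite Rmult_0_l, exp_0|].
rewrite S_INR. simpl. rewrite IH, <- exp_plus. f_equal. ring.
Qed.

Lemma exp_neg_lt_1 s : 0 < s -> 0 < exp (- s) < 1.
Proof. intros Hs. split; [apply exp_pos|]. rewrite <- exp_0. apply exp_increasing. lra. Qed.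

Lemma is_usum_exp_Zabs s :
  0 < s -> is_usum (fun n => exp (- s * IZR (Z.abs n))) (sq_bound s).
Proof.
intros Hs. pose proof (exp_neg_lt_1 s Hs) as He.
replace (sq_bound s) with (/ (1 - exp (- s)) + exp (- s) * / (1 - exp (- s)))
  by (unfold sq_bound; field; lra).
assert (Hg : is_usum (fun n => exp (- s) ^ n) (/ (1 - exp (- s)))).
{ apply is_series_usum; [|now apply is_series_exp_geom].
  intros n. apply pow_le. lra. }
apply is_usum_Z.
- eapply is_usum_ext; [|exact Hg]. intros n. simpl.
  rewrite exp_pow, Z.abs_eq by lia. rewrite <- INR_IZR_INZ. f_equal. ring.
- apply is_usum_ext with (fun n => exp (- s) * exp (- s) ^ n);
    [|apply is_usum_scal; [lra|exact Hg]].
  intros n.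
  rewrite exp_pow, <- exp_plus, Z.abs_opp, Z.abs_eq by lia.
  rewrite <- INR_IZR_INZ, S_INR. f_equal. ring.
Qed.

Lemma exp_le_compat x y : x <= y -> exp x <= exp y.
Proof. intros [H| ->]; [left; now apply exp_increasing|lra]. Qed.

(** From $|x|+|y| \le x^2+y^2 \le 2N(x+y\omega)$, the Gaussian is dominated by a product of two
    geometric families of rate $s/2$. *)
Lemma gauss_summable s :
  0 < s -> exists a, is_usum (gauss s) a /\ a <= sq_bound (s / 2) * sq_bound (s / 2).
Proof.
intros Hs.
assert (Hb : is_usum (fun n => exp (- (s / 2) * IZR (Z.abs n))) (sq_bound (s / 2)))
  by (apply is_usum_exp_Zabs; lra).
eapply is_usum_dominated; [|apply (is_usum_prod _ _ _ _ (fun x => Rlt_le _ _ (exp_pos _))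
  (fun x => Rlt_le _ _ (exp_pos _)) Hb Hb)].
intros z. cbv beta. rewrite <- exp_plus. apply exp_le_compat.
assert (IZR (Z.abs (fst z)) + IZR (Z.abs (snd z)) <= 2 * IZR (eis_norm z)).
{ rewrite <- plus_IZR, <- mult_IZR. apply IZR_le. pose proof (eis_norm_ge z).
  assert (H1 : forall x, (Z.abs x <= x * x)%Z) by (intros x; nia).
  pose proof (H1 (fst z)). pose proof (H1 (snd z)). lia. }
nra.
Qed.

Lemma is_usum_theta s : 0 < s -> is_usum (gauss s) (eis_theta s).
Proof. intros Hs. destruct (gauss_summable s Hs) as [a [Ha _]]. now apply usum_correct in Ha. Qed.

Lemma is_usum_coset s :
  0 < s -> is_usum (fun u => gauss s (pi_coset u)) (eis_coset_theta s).
Proof.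
intros Hs. destruct (is_usum_inj pi_coset (gauss s) (eis_theta s)) as [t [Ht _]].
- intros [a b] [c d]. unfold pi_coset; cbn [fst snd]. intros [H1 H2]%pair_equal_spec. f_equal; lia.
- now apply is_usum_theta.
- now apply usum_correct in Ht.
Qed.

Lemma eis_theta_le s :
  0 < s -> eis_theta s <= sq_bound (s / 2) * sq_bound (s / 2).
Proof.
intros Hs. destruct (gauss_summable s Hs) as [a [Ha Hle]].
unfold eis_theta. now rewrite (usum_unique _ _ Ha).
Qed.

Lemma eis_theta_ge_1 s : 0 < s -> 1 <= eis_theta s.
Proof.
intros Hs. replace 1 with (gauss s (0, 0)%Z).
- apply is_usum_term. now apply is_usum_theta.
- unfold gauss, eis_norm; simpl. now rewrite Rmult_0_r, exp_0.
Qed.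

Lemma eis_coset_theta_ge s : 0 < s -> exp (- s) <= eis_coset_theta s.
Proof.
intros Hs. replace (exp (- s)) with (gauss s (pi_coset (0, 0)%Z)).
- apply (is_usum_term (fun u => gauss s (pi_coset u))). now apply is_usum_coset.
- unfold gauss, eis_norm; simpl. now rewrite Rmult_1_r.
Qed.

Lemma eis_coset_norm_ge_1 u : (1 <= eis_norm (pi_coset u))%Z.
Proof.
destruct u as [m n].
pose proof (eis_norm_ge (pi_coset (m, n))). unfold eis_norm, pi_coset in *; cbn [fst snd] in *.
assert (Hne : (1 + m - 2 * n <> 0 \/ 2 * m - n <> 0)%Z) by lia.
revert H Hne. generalize (1 + m - 2 * n)%Z (2 * m - n)%Z. intros x y H Hne.
pose proof (Z.square_nonneg x). pose proof (Z.square_nonneg y).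
assert (0 < x * x + y * y)%Z by (destruct Hne; nia). lia.
Qed.

(** Every norm on the coset is at least 1, so each term gains the factor $e^{-(t-s)}$. With the
    lower bound by the single term at 1 this pins the decay of the series up to a constant
    factor. *)
Lemma eis_coset_theta_le s t :
  0 < s -> s <= t -> eis_coset_theta t <= exp (- (t - s)) * eis_coset_theta s.
Proof.
intros Hs Hst.
destruct (is_usum_dominated (fun u => gauss t (pi_coset u))
  (fun u => exp (- (t - s)) * gauss s (pi_coset u))
  (exp (- (t - s)) * eis_coset_theta s)) as [a [Ha Hle]].
- intros u. unfold gauss. rewrite <- exp_plus. apply exp_le_compat.
  pose proof (IZR_le _ _ (eis_coset_norm_ge_1 u)). nra.
- apply is_usum_scal; [apply exp_pos|]. now apply is_usum_coset.
- unfold eis_coset_theta at 1. now rewrite (usum_unique _ _ Ha).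
Qed.

(** * Residue classes modulo 3 and the cube of the coset series *)

Inductive trit := T0 | Tp | Tm.
Definition tval (i : trit) : Z := match i with T0 => 0 | Tp => 1 | Tm => -1 end.
Definition trits := [T0; Tp; Tm].

Lemma trits_NoDup : NoDup trits.
Proof. repeat constructor; simpl; intuition congruence. Qed.
Lemma trits_full i : In i trits.
Proof. destruct i; simpl; auto. Qed.

Lemma tval_mod_inj i j x y : (tval i + 3 * x = tval j + 3 * y -> i = j /\ x = y)%Z.
Proof. destruct i, j; unfold tval; intros; split; try reflexivity; try lia; exfalso; lia. Qed.

Lemma tval_mod_ex x : exists i y, (x = tval i + 3 * y)%Z.
Proof.
pose proof (Z.div_mod x 3 ltac:(lia)). pose proof (Z.mod_pos_bound x 3 ltac:(lia)).
assert (E : (x mod 3 = 0 \/ x mod 3 = 1 \/ x mod 3 = 2)%Z) by lia.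
destruct E as [E|[E|E]].
- exists T0, (x / 3)%Z. unfold tval. lia.
- exists Tp, (x / 3)%Z. unfold tval. lia.
- exists Tm, (x / 3 + 1)%Z. unfold tval. lia.
Qed.

(** The residues modulo $\pi$ are $0, 1, -1$. Multiplication by $\pi$ triples norms, which gives the
    first term, and negation exchanges the other two classes. *)
Lemma eis_theta_split s :
  0 < s -> eis_theta s = eis_theta (3 * s) + 2 * eis_coset_theta s.
Proof.
intros Hs. unfold eis_theta at 1. apply usum_unique.
set (g := fun p : trit * (Z * Z) =>
  ((tval (fst p) + fst (snd p) - 2 * snd (snd p)),
   (2 * fst (snd p) - snd (snd p)))%Z).
apply (is_usum_bij g).
- intros [i [m n]] [j [m' n']]. unfold g; cbn [fst snd]. intros [H1 H2]%pair_equal_spec.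
  destruct (tval_mod_inj i j (m - n - (m' - n')) 0) as [-> H3]; [lia|].
  f_equal. f_equal; lia.
- intros [x y]. destruct (tval_mod_ex (x + y)) as [i [k Hk]].
  exists (i, (k - (x - tval i - k), 2 * k - 2 * (x - tval i - k) - y))%Z.
  unfold g; cbn [fst snd]. f_equal; lia.
- replace (eis_theta (3 * s) + 2 * eis_coset_theta s)
    with (lsum (fun i => match i with T0 => eis_theta (3 * s) | _ => eis_coset_theta s end) trits)
    by (simpl; ring).
  apply is_usum_fin; [apply trits_NoDup|apply trits_full|].
  intros [].
  + eapply is_usum_ext; [|apply (is_usum_theta (3 * s)); lra].
    intros [m n]. apply gauss_scale. unfold g, eis_norm; cbn [fst snd tval]. ring.
  + now apply is_usum_coset.
  + apply (is_usum_bij (fun u : Z * Z => (- fst u, - snd u)%Z)).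
    * intros [a b] [c d]; cbn [fst snd]. intros [H1 H2]%pair_equal_spec. f_equal; lia.
    * intros [a b]. exists (- a, - b)%Z. cbn [fst snd]. f_equal; lia.
    * eapply is_usum_ext; [|now apply is_usum_coset].
      intros [m n]. apply gauss_eq.
      unfold g, pi_coset, eis_norm; cbn [fst snd tval]. ring.
Qed.

(* The point [c + pi i + 3 p], where [pi = 1 + 2 omega]; [(x, y)] stands for [x + y omega]. *)
Definition class_point (c i : trit) (p : Z * Z) : Z * Z :=
  (tval c + tval i + 3 * fst p, 2 * tval i + 3 * snd p)%Z.

(** Because $3 = -\pi^2$, a class modulo 3 inside $\pi\mathbb Z[\omega]$ is $\pi$ times a class
    modulo $\pi$, with norms tripled. Each of the cosets $\pm1+\pi\mathbb Z[\omega]$ splits into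
    three classes modulo 3 with equal sums. *)
Definition class_sum (s : R) (c i : trit) : R :=
  match c, i with
  | T0, T0 => eis_theta (9 * s)
  | T0, _ => eis_coset_theta (3 * s)
  | _, _ => eis_coset_theta s / 3
  end.

Lemma is_usum_neg (f : Z * Z -> R) s :
  is_usum (fun u => f (- fst u, - snd u)%Z) s <-> is_usum f s.
Proof.
apply (is_usum_bij (fun u : Z * Z => (- fst u, - snd u)%Z)).
- intros [a b] [c d]; cbn [fst snd]. intros [H1 H2]%pair_equal_spec. f_equal; lia.
- intros [a b]. exists (- a, - b)%Z. cbn [fst snd]. f_equal; lia.
Qed.

(** The reindexing is multiplication by $\omega$ followed by a translation. *)
Lemma is_usum_rot (f : Z * Z -> R) s a b :
  is_usum (fun u => f (- snd u + a, fst u - snd u + b)%Z) s <-> is_usum f s.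
Proof.
apply (is_usum_bij (fun u : Z * Z => (- snd u + a, fst u - snd u + b)%Z)).
- intros [x y] [c d]; cbn [fst snd]. intros [H1 H2]%pair_equal_spec. f_equal; lia.
- intros [x y]. exists (y - b - (x - a), - (x - a))%Z. cbn [fst snd]. f_equal; lia.
Qed.

(* The classes [1 + pi i] modulo 3 are permuted by the cube roots of unity. *)
Lemma is_usum_class_unit s i :
  0 < s -> is_usum (fun p => gauss s (class_point Tp i p)) (eis_coset_theta s / 3).
Proof.
intros Hs.
assert (H0 : exists t, is_usum (fun p => gauss s (class_point Tp T0 p)) t).
{ destruct (is_usum_inj (class_point Tp T0) (gauss s) (eis_theta s)) as [t [Ht _]].
  - intros [a b] [c d]. unfold class_point; cbn [fst snd tval].
    intros [H1 H2]%pair_equal_spec. f_equal; lia.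
  - now apply is_usum_theta.
  - eauto. }
destruct H0 as [t H0].
(* Here $\omega = 1 - \pi + 3\omega$, which explains the shift by $(0,1)$; one more multiplication
   by $\omega$ leads to the class of $1+\pi$ without a shift. *)
assert (Hm : is_usum (fun p => gauss s (class_point Tp Tm p)) t).
{ apply (is_usum_rot _ _ 0 1). eapply is_usum_ext; [|exact H0].
  intros [a b]. apply gauss_eq. unfold class_point, eis_norm; cbn [fst snd tval]. ring. }
assert (Hp : is_usum (fun p => gauss s (class_point Tp Tp p)) t).
{ apply (is_usum_rot _ _ 0 0). eapply is_usum_ext; [|exact Hm].
  intros [a b]. apply gauss_eq. unfold class_point, eis_norm; cbn [fst snd tval]. ring. }
assert (Hc : eis_coset_theta s = lsum (fun _ : trit => t) trits).
{ apply usum_unique.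
  (* The index is $u = k - \pi p$, so that $1 + \pi u = 1 + \pi k + 3p$. *)
  apply (is_usum_bij (fun q : trit * (Z * Z) =>
    (tval (fst q) + 2 * snd (snd q) - fst (snd q), snd (snd q) - 2 * fst (snd q))%Z)).
  - intros [k [a b]] [j [c d]]; cbn [fst snd]. intros [H1 H2]%pair_equal_spec.
    destruct (tval_mod_inj k j (b - a) (d - c)) as [-> H3]; [lia|].
    f_equal. f_equal; lia.
  - intros [m n]. destruct (tval_mod_ex (m + n)) as [k [y Hy]].
    exists (k, (y - n, 2 * y - n)%Z). cbn [fst snd]. f_equal; lia.
  - apply is_usum_fin; [apply trits_NoDup|apply trits_full|].
    intros k. cbn [fst snd]. apply is_usum_ext with (fun p => gauss s (class_point Tp k p)).
    + intros [a b]. f_equal. unfold class_point, pi_coset; cbn [fst snd].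
      change (tval Tp) with 1%Z. f_equal; ring.
    + destruct k; assumption. }
replace (eis_coset_theta s / 3) with t by (rewrite Hc; simpl; field).
destruct i; assumption.
Qed.

Lemma is_usum_class s c i :
  0 < s -> is_usum (fun p => gauss s (class_point c i p)) (class_sum s c i).
Proof.
intros Hs. destruct c; [destruct i| |].
- eapply is_usum_ext; [|apply (is_usum_theta (9 * s)); lra].
  intros [a b]. apply gauss_scale. unfold class_point, eis_norm; cbn [fst snd tval]. ring.
- apply is_usum_neg. eapply is_usum_ext; [|apply (is_usum_coset (3 * s)); lra].
  intros [a b]. apply gauss_scale.
  unfold class_point, pi_coset, eis_norm; cbn [fst snd tval]. ring.
- eapply is_usum_ext; [|apply (is_usum_coset (3 * s)); lra].
  intros [a b]. apply gauss_scale.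
  unfold class_point, pi_coset, eis_norm; cbn [fst snd tval]. ring.
- replace (class_sum s Tp i) with (eis_coset_theta s / 3) by (now destruct i).
  now apply is_usum_class_unit.
- replace (class_sum s Tm i) with (eis_coset_theta s / 3) by (now destruct i).
  apply is_usum_neg.
  set (j := match i with T0 => T0 | Tp => Tm | Tm => Tp end).
  eapply is_usum_ext; [|apply (is_usum_class_unit s j Hs)].
  intros [a b]. apply gauss_eq.
  destruct i; unfold class_point, eis_norm; cbn [fst snd tval j]; ring.
Qed.

(* [third i j] is the class [k] with [i + j + k = -1] modulo 3. *)
Definition third (i j : trit) : trit :=
  match i, j with
  | T0, T0 => Tm | T0, Tp => Tp | T0, Tm => T0
  | Tp, T0 => Tp | Tp, Tp => T0 | Tp, Tm => Tm
  | Tm, T0 => T0 | Tm, Tp => Tm | Tm, Tm => Tp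
  end.

Definition carry (i j : trit) : Z := ((tval i + tval j + tval (third i j) + 1) / 3)%Z.

Lemma carry_spec i j : (tval i + tval j + tval (third i j) + 1 = 3 * carry i j)%Z.
Proof. now destruct i, j. Qed.

Lemma third_unique i j k x : (tval i + tval j + tval k + 1 = 3 * x)%Z -> k = third i j.
Proof. destruct i, j, k; unfold tval; intros; try reflexivity; exfalso; lia. Qed.

Definition cube_index : Type := (trit * (trit * trit)) * ((Z * Z) * ((Z * Z) * (Z * Z))).

(* The inverse of the discrete Fourier transform
   [P = u + v + w - pi, R = u + omega v + omega^2 w, S = u + omega^2 v + omega w],
   where [P, R, S] lie in the classes [c + pi i, c + pi j, c + pi k] modulo 3. *)
Definition fourier (q : cube_index) : (Z * Z) * ((Z * Z) * (Z * Z)) :=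
  let '((c, (i, j)), ((p1, p2), ((r1, r2), (s1, s2)))) := q in
  let l := carry i j in
  let k := third i j in
  ((tval c + l + p1 + r1 + s1, 2 * l + p2 + r2 + s2),
   ((l - tval k + p1 - r1 + r2 - s2, 2 * l - tval j - tval k + p2 - r1 + s1 - s2),
    (l - tval j + p1 - r2 - s1 + s2, 2 * l - tval j - tval k + p2 + r1 - r2 - s1)))%Z.

(** The forward transform in coordinates. It reduces injectivity and surjectivity of [fourier] to
    uniqueness and existence of the representation by [class_point]. *)
Lemma fourier_P c i j p1 p2 r1 r2 s1 s2 u1 u2 v1 v2 w1 w2 :
  fourier ((c, (i, j)), ((p1, p2), ((r1, r2), (s1, s2)))) = ((u1, u2), ((v1, v2), (w1, w2))) <->
  (class_point c i (p1, p2) = (u1 + v1 + w1 - 1, u2 + v2 + w2 - 2) /\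
   class_point c j (r1, r2) = (u1 - v2 - w1 + w2, u2 + v1 - v2 - w1) /\
   class_point c (third i j) (s1, s2) = (u1 - v1 + v2 - w2, u2 - v1 + w1 - w2))%Z.
Proof.
pose proof (carry_spec i j) as Hl.
unfold fourier, class_point; cbn [fst snd].
set (l := carry i j) in *. set (k := third i j) in *.
generalize dependent k. intros k. generalize dependent l. intros l Hl.
split.
- intros [[A1 A2]%pair_equal_spec
    [[A3 A4]%pair_equal_spec [A5 A6]%pair_equal_spec]%pair_equal_spec]%pair_equal_spec.
  repeat split; f_equal; lia.
- intros [[H1 H2]%pair_equal_spec [[H3 H4]%pair_equal_spec [H5 H6]%pair_equal_spec]].
  repeat f_equal; lia.
Qed.

Lemma class_point_inj c i p c' i' p' :
  class_point c i p = class_point c' i' p' -> c = c' /\ i = i' /\ p = p'.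
Proof.
destruct p as [a b], p' as [a' b']. unfold class_point; cbn [fst snd].
intros [H1 H2]%pair_equal_spec.
destruct (tval_mod_inj i i' (b' - b - tval i + tval i') 0) as [-> _]; [lia|].
destruct (tval_mod_inj c c' a a') as [-> Ha]; [lia|].
repeat split. f_equal; lia.
Qed.

Lemma class_point_ex x y : exists c i p, class_point c i p = (x, y).
Proof.
destruct (tval_mod_ex (- y)) as [i [m Hm]].
destruct (tval_mod_ex (x - tval i)) as [c [a Ha]].
exists c, i, (a, - m - tval i)%Z. unfold class_point; cbn [fst snd]. f_equal; lia.
Qed.

Lemma fourier_inj q q' : fourier q = fourier q' -> q = q'.
Proof.
destruct q as [[c [i j]] [[p1 p2] [[r1 r2] [s1 s2]]]].
destruct q' as [[c' [i' j']] [[p1' p2'] [[r1' r2'] [s1' s2']]]].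
destruct (fourier ((c', (i', j')), ((p1', p2'), ((r1', r2'), (s1', s2')))))
  as [[u1 u2] [[v1 v2] [w1 w2]]] eqn:E'. intros E.
apply fourier_P in E, E'. destruct E as [E1 [E2 E3]]. destruct E' as [E1' [E2' E3']].
rewrite <- E1' in E1. rewrite <- E2' in E2. rewrite <- E3' in E3.
apply class_point_inj in E1, E2, E3.
destruct E1 as [-> [-> [= -> ->]]]. destruct E2 as [_ [-> [= -> ->]]].
now destruct E3 as [_ [_ [= -> ->]]].
Qed.

Lemma fourier_surj t : exists q, fourier q = t.
Proof.
destruct t as [[u1 u2] [[v1 v2] [w1 w2]]].
destruct (class_point_ex (u1 + v1 + w1 - 1) (u2 + v2 + w2 - 2)) as [c [i [[p1 p2] E1]]].
destruct (class_point_ex (u1 - v2 - w1 + w2) (u2 + v1 - v2 - w1)) as [c2 [j [[r1 r2] E2]]].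
destruct (class_point_ex (u1 - v1 + v2 - w2) (u2 - v1 + w1 - w2)) as [c3 [k [[s1 s2] E3]]].
(* Modulo $\pi$ one has $\omega \equiv 1$, so $P$, $R$ and $S$ are congruent; the residue of $x +
   y\omega$ is $x + y$ modulo 3. *)
assert (Hc2 : c2 = c).
{ unfold class_point in *; cbn [fst snd] in *.
  apply pair_equal_spec in E1 as [A1 A2]. apply pair_equal_spec in E2 as [B1 B2].
  destruct (tval_mod_inj c2 c (r1 + tval j + r2 - p1 - tval i - p2 + v2 + w1) 1) as [E _]; [|exact E].
  lia. }
assert (Hc3 : c3 = c).
{ unfold class_point in *; cbn [fst snd] in *.
  apply pair_equal_spec in E1 as [A1 A2]. apply pair_equal_spec in E3 as [B1 B2].
  destruct (tval_mod_inj c3 c (s1 + tval k + s2 - p1 - tval i - p2 + v1 + w2) 1) as [E _]; [|exact E].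
  lia. }
subst c2 c3.
(* Adding the three forms gives $P+R+S = 3u - \pi$; its first coordinate shows that $i+j+k+1$ is
   divisible by 3, with the stated quotient. *)
assert (Hk : k = third i j).
{ unfold class_point in *; cbn [fst snd] in *.
  apply pair_equal_spec in E1 as [A1 A2]. apply pair_equal_spec in E2 as [B1 B2].
  apply pair_equal_spec in E3 as [C1 C2].
  apply (third_unique i j k (u1 - tval c - p1 - r1 - s1)). lia. }
subst k.
exists ((c, (i, j)), ((p1, p2), ((r1, r2), (s1, s2)))). apply fourier_P. auto.
Qed.

(** With $A$ = [eis_theta (9 * s)] and $B$ = [eis_coset_theta (3 * s)], the right side is
    $(A+2B)^3-(A-B)^3$, that is $a^3-b^3$. The engine is Parseval: the transform of $(1+\pi u, 1+\pi
    v, 1+\pi w)$ is $\pi(P,R,S)$, where $3=-\pi^2$ produces the $-\pi$ in $P$. Hence the three norms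
    add up to $N(P)+N(R)+N(S)$. *)
Lemma eis_coset_cube s :
  0 < s ->
  eis_coset_theta s ^ 3 =
  9 * eis_coset_theta (3 * s) *
    (eis_theta (9 * s) ^ 2 + eis_theta (9 * s) * eis_coset_theta (3 * s)
     + eis_coset_theta (3 * s) ^ 2).
Proof.
intros Hs.
set (g := fun u => gauss s (pi_coset u)).
assert (Hg : forall u, 0 <= g u) by (intros u; left; apply gauss_pos).
assert (H2 : forall p : (Z * Z) * (Z * Z), 0 <= g (fst p) * g (snd p))
  by (intros; now apply Rmult_le_pos).
pose proof (is_usum_coset s Hs) as Hc. fold g in Hc.
pose proof (is_usum_prod _ _ _ _ Hg H2 Hc (is_usum_prod _ _ _ _ Hg Hg Hc Hc)) as HL.
apply (is_usum_bij fourier _ _ fourier_inj fourier_surj) in HL.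
set (S := fun a : trit * (trit * trit) =>
  class_sum s (fst a) (fst (snd a)) *
  (class_sum s (fst a) (snd (snd a)) *
   class_sum s (fst a) (third (fst (snd a)) (snd (snd a))))).
assert (HR : is_usum (fun q : cube_index =>
   let '((c, (i, j)), (p, (r, t))) := q in
   gauss s (class_point c i p) * (gauss s (class_point c j r) *
     gauss s (class_point c (third i j) t)))
  (lsum S (list_prod trits (list_prod trits trits)))).
{ apply is_usum_fin.
  - vm_compute. repeat constructor; simpl; intuition congruence.
  - intros [c [i j]]. repeat (apply in_prod); apply trits_full.
  - intros [c [i j]].
    assert (Hp : forall i p, 0 <= gauss s (class_point c i p)) by (intros; left; apply gauss_pos).
    eapply is_usum_ext; [|apply (is_usum_prod _
      (fun rt => gauss s (class_point c j (fst rt)) *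
        gauss s (class_point c (third i j) (snd rt))) _ _ (Hp i))].
    + intros [p [r t]]. reflexivity.
    + intros; now apply Rmult_le_pos.
    + now apply is_usum_class.
    + apply (is_usum_prod (fun p => gauss s (class_point c j p))
        (fun p => gauss s (class_point c (third i j) p))); auto; now apply is_usum_class. }
assert (E : eis_coset_theta s * (eis_coset_theta s * eis_coset_theta s)
  = lsum S (list_prod trits (list_prod trits trits))).
{ apply (is_usum_unique _ _ _ HL). eapply is_usum_ext; [|exact HR].
  intros q. destruct (fourier q) as [[u1 u2] [[v1 v2] [w1 w2]]] eqn:Eq.
  destruct q as [[c [i j]] [[p1 p2] [[r1 r2] [s1 s2]]]].
  apply fourier_P in Eq. destruct Eq as [E1 [E2 E3]]. rewrite E1, E2, E3.
  unfold g, gauss. cbn [fst snd]. rewrite <- !exp_plus. f_equal.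
  rewrite <- !Rmult_plus_distr_l, <- !plus_IZR. do 2 f_equal.
  unfold eis_norm, pi_coset; cbn [fst snd]. ring. }
(* With $C$ = [eis_coset_theta s], the nine triples with $c=0$ contribute $3A^2B+3AB^2+3B^3$, and
   each of $c=\pm1$ contributes $9(C/3)^3$. The resulting equation $C^3 = 3B(A^2+AB+B^2)+\frac23C^3$
   is solved for $C^3$. *)
simpl in E. unfold S in E. simpl in E.
nra.
Qed.

(** * Hypergeometric functions and the cubic transformation *)

Lemma Derive_eq (f : R -> R) (x l : R) : is_derive f x l -> Derive (fun t => f t) x = l.
Proof. apply is_derive_unique. Qed.

Lemma is_derive_ext_R (f g : R -> R) (x l : R) :
  (forall t : R, f t = g t) -> is_derive f x l -> is_derive g x l.
Proof. intros H. now apply is_derive_ext. Qed.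

Lemma is_derive_ext_pos (f g : R -> R) (x l : R) :
  0 < x -> (forall t : R, 0 < t -> f t = g t) -> is_derive f x l -> is_derive g x l.
Proof.
intros Hx H. apply is_derive_ext_loc. exists (mkposreal x Hx). intros t Ht. apply H.
unfold ball in Ht; simpl in Ht. unfold AbsRing_ball, abs, minus, plus, opp in Ht; simpl in Ht.
apply Rabs_def2 in Ht. lra.
Qed.

Fixpoint rising (a : R) (n : nat) : R :=
  match n with O => 1 | S m => rising a m * (a + INR m) end.

Definition hyp (a b c : R) (n : nat) : R :=
  rising a n * rising b n / (rising c n * INR (fact n)).

Lemma rising_pos a n : 0 < a -> 0 < rising a n.
Proof.
intros Ha. induction n as [|n IH]; simpl; [lra|].
apply Rmult_lt_0_compat; [easy|]. pose proof (pos_INR n). lra.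
Qed.

Lemma hyp_S a b c n :
  0 < c -> hyp a b c (S n) * ((c + INR n) * (1 + INR n)) =
  hyp a b c n * ((a + INR n) * (b + INR n)).
Proof.
intros Hc. unfold hyp. rewrite fact_simpl, mult_INR, S_INR. simpl rising.
pose proof (rising_pos c n Hc). pose proof (INR_fact_lt_0 n). pose proof (pos_INR n).
field. lra.
Qed.

Lemma hyp_pos a b c n : 0 < a -> 0 < b -> 0 < c -> 0 < hyp a b c n.
Proof.
intros Ha Hb Hc. unfold hyp.
apply Rdiv_lt_0_compat; apply Rmult_lt_0_compat;
  try (now apply rising_pos); apply INR_fact_lt_0.
Qed.

Lemma is_pseries_lin (a b : nat -> R) (x la lb u v : R) :
  is_pseries a x la -> is_pseries b x lb ->
  is_pseries (fun n => u * a n + v * b n) x (u * la + v * lb).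
Proof.
intros Ha Hb.
apply (is_pseries_ext (PS_plus (PS_scal u a) (PS_scal v b))); [easy|].
apply (is_pseries_plus (PS_scal u a) (PS_scal v b) x (u * la) (v * lb));
  apply @is_pseries_scal; try easy; apply Rmult_comm.
Qed.

(* Parameters for which the coefficients of the hypergeometric series lie in [0,1]. *)
Definition hyp_ok (a b c : R) : Prop :=
  0 < a /\ 0 < b /\ 0 < c /\ a + b <= c + 1 /\ a * b <= c.

(** The two inequalities of [hyp_ok] compare the coefficients of $(a+n)(b+n)$ and $(c+n)(1+n)$, so
    consecutive ratios never exceed 1. Bounded coefficients then give a radius of convergence of at
    least 1. *)
Lemma hyp_le_1 a b c n : hyp_ok a b c -> hyp a b c n <= 1.
Proof.
intros [Ha [Hb [Hc [H1 H2]]]].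
induction n as [|n IH].
- unfold hyp; simpl. lra.
- pose proof (hyp_S a b c n Hc) as H. pose proof (pos_INR n).
  pose proof (hyp_pos a b c n Ha Hb Hc).
  assert (Hp : 0 < (c + INR n) * (1 + INR n)) by nra.
  apply (Rmult_le_reg_r _ _ _ Hp). rewrite H, Rmult_1_l.
  apply Rle_trans with (1 * ((a + INR n) * (b + INR n))).
  + apply Rmult_le_compat_r; nra.
  + nra.
Qed.

Definition hypF a b c := PSeries (hyp a b c).
Definition hypF1 a b c := PSeries (PS_derive (hyp a b c)).
Definition hypF2 a b c := PSeries (PS_derive (PS_derive (hyp a b c))).

Lemma hyp_radius a b c z : hyp_ok a b c -> Rabs z < 1 -> Rbar_lt (Rabs z) (CV_radius (hyp a b c)).
Proof.
intros Hok Hz. apply Rbar_lt_le_trans with (Finite 1); [exact Hz|].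
apply CV_radius_bounded. exists 1. intros n. rewrite pow1, Rmult_1_r.
rewrite Rabs_pos_eq; [now apply hyp_le_1|].
destruct Hok as [Ha [Hb [Hc _]]]. left; now apply hyp_pos.
Qed.

Lemma is_derive_hypF a b c z :
  hyp_ok a b c -> Rabs z < 1 -> is_derive (hypF a b c) z (hypF1 a b c z).
Proof. intros Hok Hz. apply is_derive_PSeries. now apply hyp_radius. Qed.

Lemma is_derive_hypF1 a b c z :
  hyp_ok a b c -> Rabs z < 1 -> is_derive (hypF1 a b c) z (hypF2 a b c z).
Proof.
intros Hok Hz. apply is_derive_PSeries. rewrite CV_radius_derive. now apply hyp_radius.
Qed.

Lemma hyp_ode a b c z : hyp_ok a b c -> Rabs z < 1 ->
  z * (1 - z) * hypF2 a b c z + (c - (a + b + 1) * z) * hypF1 a b c z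
  = a * b * hypF a b c z.
Proof.
intros Hok Hz. pose proof (hyp_radius a b c z Hok Hz) as Hr.
assert (H0 : is_pseries (hyp a b c) z (hypF a b c z)).
{ apply PSeries_correct, CV_radius_inside, Hr. }
assert (H1 : is_pseries (PS_derive (hyp a b c)) z (hypF1 a b c z)).
{ apply PSeries_correct, CV_radius_inside. now rewrite CV_radius_derive. }
assert (H2 : is_pseries (PS_derive (PS_derive (hyp a b c))) z (hypF2 a b c z)).
{ apply PSeries_correct, CV_radius_inside. now rewrite !CV_radius_derive. }
pose proof (is_pseries_incr_1 _ _ _ H2) as H3.
pose proof (is_pseries_incr_1 _ _ _ H3) as H4.
pose proof (is_pseries_incr_1 _ _ _ H1) as H5.
pose proof (is_pseries_lin _ _ _ _ _ 1 (-1) H3 H4) as L1.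
pose proof (is_pseries_lin _ _ _ _ _ c (- (a + b + 1)) H1 H5) as L2.
pose proof (is_pseries_lin _ _ _ _ _ 1 1 L1 L2) as L3.
pose proof (is_pseries_lin _ _ _ _ _ 1 (- (a * b)) L3 H0) as L4.
apply is_pseries_unique in L4.
rewrite (PSeries_ext _ (fun _ => 0)) in L4.
- rewrite PSeries_const_0 in L4. unfold scal in L4; simpl in L4. unfold mult in L4; simpl in L4.
  lra.
- destruct Hok as [_ [_ [Hc _]]]. clear - Hc.
  (* The coefficient identity is [hyp_S]; indices 0 and 1 stand apart because multiplication by $z$
     and $z^2$ pads the shifted sequences with zeros. *)
  intros n. unfold PS_incr_1, PS_derive, zero; simpl.
  destruct n as [|[|n]].
  + pose proof (hyp_S a b c 0 Hc) as H. simpl in *. lra.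
  + pose proof (hyp_S a b c 1 Hc) as H. simpl in *. lra.
  + pose proof (hyp_S a b c (S (S n)) Hc) as H. rewrite !S_INR in *. 
    change (match n with O => 1 | S _ => INR n + 1 end) with (INR (S n)) in *.
    rewrite ?S_INR in *. lra.
Qed.

Lemma hypF_0 a b c : hypF a b c 0 = 1.
Proof. unfold hypF. rewrite PSeries_0. unfold hyp; simpl. field. Qed.

Lemma PSeries_ge_head (d : nat -> R) (x : R) :
  (forall n, 0 <= d n) -> 0 <= x -> ex_pseries d x -> d O <= PSeries d x.
Proof.
intros Hd Hx He. rewrite PSeries_decr_1 by easy.
enough (0 <= PSeries (PS_decr_1 d) x) by nra.
rewrite <- (PSeries_const_0 x). apply Series_le.
- intros n. rewrite Rmult_0_l. split; [lra|].
  apply Rmult_le_pos; [apply Hd|now apply pow_le].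
- apply ex_pseries_R. apply ex_pseries_decr_1; [|easy].
  destruct (Req_dec x 0) as [->|Hx0]; [now left|right].
  exists (/ x). now apply Rinv_l.
Qed.

Lemma hypF_ge_1 a b c z : hyp_ok a b c -> 0 <= z < 1 -> 1 <= hypF a b c z.
Proof.
intros Hok Hz. replace 1 with (hyp a b c 0) by (unfold hyp; simpl; field).
apply PSeries_ge_head; [|lra|].
- intros n. destruct Hok as [Ha [Hb [Hc _]]]. left. now apply hyp_pos.
- apply CV_radius_inside, hyp_radius; [easy|]. apply Rabs_def1; lra.
Qed.

Lemma continuous_hypF a b c z : hyp_ok a b c -> Rabs z < 1 -> continuous (hypF a b c) z.
Proof.
intros Hok Hz. apply (ex_derive_continuous (hypF a b c)).
eexists. now apply is_derive_hypF.
Qed.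

Lemma hypF_incr a b c x y :
  hyp_ok a b c -> 0 <= x -> x < y -> y < 1 -> hypF a b c x < hypF a b c y.
Proof.
intros Hok Hx Hxy Hy.
destruct (MVT_gen (hypF a b c) x y (hypF1 a b c)) as [t [Ht E]];
  rewrite Rmin_left, Rmax_right in * by lra.
- intros t Ht. apply is_derive_hypF; [easy|]. apply Rabs_def1; lra.
- intros t Ht. apply continuity_pt_filterlim, continuous_hypF; [easy|]. apply Rabs_def1; lra.
- enough (0 < hypF1 a b c t) by nra.
  destruct Hok as [Ha [Hb [Hc H]]].
  apply Rlt_le_trans with (PS_derive (hyp a b c) 0).
  + unfold PS_derive. apply Rmult_lt_0_compat; [simpl; lra|now apply hyp_pos].
  + apply PSeries_ge_head; [|lra|].
    * intros n. unfold PS_derive.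
      apply Rmult_le_pos; [apply pos_INR|left; now apply hyp_pos].
    * apply CV_radius_inside. rewrite CV_radius_derive.
      apply hyp_radius; [easy|]. apply Rabs_def1; lra.
Qed.

(* The weighted Wronskian [p (f g' - g f')] is constant. *)
Lemma sturm_liouville_proportional (p r f f1 g g1 : R -> R) (a b : R) :
  a < b ->
  (forall x, a <= x <= b -> is_derive f x (f1 x)) ->
  (forall x, a <= x <= b -> is_derive g x (g1 x)) ->
  (forall x, a <= x <= b -> is_derive (fun t => p t * f1 t) x (r x * f x)) ->
  (forall x, a <= x <= b -> is_derive (fun t => p t * g1 t) x (r x * g x)) ->
  (forall x, a <= x < b -> p x <> 0) ->
  (forall x, a <= x <= b -> g x <> 0) ->
  p b * f1 b * g b = p b * g1 b * f b ->
  f a / g a = f b / g b.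
Proof.
intros Hab Hf Hg Hpf Hpg Hp Hg0 Hb.
set (W := fun x => f x * (p x * g1 x) - g x * (p x * f1 x)).
assert (HW : forall x, a <= x <= b -> W x = 0).
{ intros x Hx. destruct (Rle_lt_or_eq_dec x b) as [Hxb| ->]; [easy| |unfold W; lra].
  rewrite (eq_is_derive W x b); [unfold W; lra| |easy].
  intros t Ht. assert (Ht' : a <= t <= b) by lra.
  specialize (Hf t Ht'). specialize (Hg t Ht'). specialize (Hpf t Ht'). specialize (Hpg t Ht').
  unfold W. evar_last.
  - apply @is_derive_minus; apply @is_derive_mult; eauto; intros; apply Rmult_comm.
  - unfold minus, plus, opp, mult, zero; simpl. ring. }
(* The weight may vanish at $b$, so it is cancelled only to the left of $b$; this is enough for the
   mean value theorem. *)
assert (HW' : forall x, a <= x < b -> f1 x * g x - f x * g1 x = 0).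
{ intros x Hx. specialize (HW x ltac:(lra)). unfold W in HW. specialize (Hp x Hx).
  apply (Rmult_eq_reg_l (p x)); [|easy]. lra. }
destruct (MVT_gen (fun x => f x / g x) a b (fun _ => 0)) as [t [_ E]];
  rewrite ?Rmin_left, ?Rmax_right in * by lra.
- intros x Hx. replace 0 with ((f1 x * g x - f x * g1 x) / (g x) ^ 2).
  + apply is_derive_div; [apply Hf|apply Hg|apply Hg0]; lra.
  + rewrite HW' by lra. unfold Rdiv. ring.
- intros x Hx. apply continuity_pt_filterlim.
  apply (ex_derive_continuous (fun x => f x / g x)). eexists.
  apply is_derive_div; [apply Hf|apply Hg|apply Hg0]; lra.
- lra.
Qed.

(** * The cubic transformation of 2F1(1/3,2/3;1) *)

Lemma hyp_ok_F : hyp_ok (1 / 3) (2 / 3) 1.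
Proof. unfold hyp_ok. lra. Qed.
Lemma hyp_ok_E : hyp_ok (1 / 6) (1 / 3) (1 / 2).
Proof. unfold hyp_ok. lra. Qed.

Definition cubF := hypF (1 / 3) (2 / 3) 1.
Definition cubF1 := hypF1 (1 / 3) (2 / 3) 1.

Lemma is_derive_cubF z : Rabs z < 1 -> is_derive cubF z (cubF1 z).
Proof. apply is_derive_hypF, hyp_ok_F. Qed.

Lemma is_derive_cubF_sl z :
  Rabs z < 1 -> is_derive (fun t => t * (1 - t) * cubF1 t) z (2 / 9 * cubF z).
Proof.
intros Hz. pose proof (hyp_ode _ _ _ z hyp_ok_F Hz) as H.
pose proof (is_derive_hypF1 _ _ _ z hyp_ok_F Hz) as H1. fold cubF1 in H1.
fold cubF1 cubF in H.
auto_derive; [now exists (hypF2 (1 / 3) (2 / 3) 1 z)|].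
rewrite (Derive_eq cubF1 _ _ H1). lra.
Qed.

Lemma cubF_ge_1 z : 0 <= z < 1 -> 1 <= cubF z.
Proof. apply hypF_ge_1, hyp_ok_F. Qed.

Lemma Rabs_lt_1_intro z : -1 < z < 1 -> Rabs z < 1.
Proof. intros H. apply Rabs_def1; lra. Qed.

(** The cubic counterpart of Landen's $(1-x)/(1+x)$: an involution, with $(1+2x)(1+2y)=3$ for $y$
    the image of $x$. *)
Definition cubic_moebius (x : R) : R := (1 - x) / (1 + 2 * x).

Lemma cubic_moebius_bound x : 0 < x <= 1 -> 0 <= cubic_moebius x < 1.
Proof.
intros Hx. unfold cubic_moebius. split.
- apply Rdiv_le_0_compat; lra.
- apply (Rmult_lt_reg_r (1 + 2 * x)); [lra|].
  unfold Rdiv. rewrite Rmult_assoc, Rinv_l; lra.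
Qed.

Lemma cube_bound y : 0 <= y < 1 -> 0 <= y ^ 3 < 1.
Proof. intros Hy. split; [apply pow_le; lra|]. simpl. nra. Qed.

Lemma is_derive_moebius t : 0 < t -> is_derive cubic_moebius t (- 3 / (1 + 2 * t) ^ 2).
Proof. intros Ht. unfold cubic_moebius. auto_derive; [lra|]. field. lra. Qed.

Lemma is_derive_moebius_cube t :
  0 < t -> is_derive (fun u => cubic_moebius u ^ 3) t
    (3 * cubic_moebius t ^ 2 * (- 3 / (1 + 2 * t) ^ 2)).
Proof.
intros Ht. pose proof (is_derive_moebius t Ht) as H.
auto_derive; [now exists (- 3 / (1 + 2 * t) ^ 2)|].
rewrite (Derive_eq cubic_moebius _ _ H). ring.
Qed.

(* Both sides solve [(x (1 - x^3) H')' = 2 x^2 H] and are smooth at the singular point [x = 1]. *)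
Lemma cubF_transform x :
  0 < x < 1 -> cubF (1 - x ^ 3) = 3 / (1 + 2 * x) * cubF (cubic_moebius x ^ 3).
Proof.
intros Hx.
assert (Hz : forall t, x <= t <= 1 -> Rabs (1 - t ^ 3) < 1).
{ intros t Ht. apply Rabs_lt_1_intro. assert (0 < t ^ 3) by (apply pow_lt; lra).
  assert (t ^ 3 <= 1) by (rewrite <- (pow1 3); apply pow_incr; lra). lra. }
assert (Hy : forall t, x <= t <= 1 -> Rabs (cubic_moebius t ^ 3) < 1).
{ intros t Ht. apply Rabs_lt_1_intro.
  pose proof (cube_bound _ (cubic_moebius_bound t ltac:(lra))). lra. }
set (f := fun t => cubF (1 - t ^ 3)).
set (f1 := fun t => - 3 * t ^ 2 * cubF1 (1 - t ^ 3)).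
set (g := fun t => 3 / (1 + 2 * t) * cubF (cubic_moebius t ^ 3)).
set (g1 := fun t => - 6 / (1 + 2 * t) ^ 2 * cubF (cubic_moebius t ^ 3)
  - 27 / (1 + 2 * t) ^ 3 * cubic_moebius t ^ 2 * cubF1 (cubic_moebius t ^ 3)).
assert (Hg1 : 1 <= g 1 /\ f 1 = g 1).
{ unfold f, g, cubic_moebius. replace (1 - 1 ^ 3) with 0 by ring.
  replace (((1 - 1) / (1 + 2 * 1)) ^ 3) with 0 by field.
  unfold cubF. rewrite hypF_0. lra. }
assert (Hg : forall t, x <= t <= 1 -> g t <> 0).
{ intros t Ht. unfold g.
  pose proof (cubF_ge_1 _ (cube_bound _ (cubic_moebius_bound t ltac:(lra)))).
  apply Rgt_not_eq, Rmult_lt_0_compat; [apply Rdiv_lt_0_compat|]; lra. }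
enough (H : f x / g x = f 1 / g 1).
{ destruct Hg1 as [Hg1 E]. rewrite E in H. unfold Rdiv at 2 in H. rewrite Rinv_r in H by lra.
  specialize (Hg x ltac:(lra)).
  change (f x = g x). rewrite <- (Rmult_1_l (g x)), <- H. field. easy. }
apply (sturm_liouville_proportional (fun t => t * (1 - t ^ 3)) (fun t => 2 * t ^ 2) f f1 g g1).
- lra.
- intros t Ht. evar_last.
  + apply (is_derive_comp cubF (fun u => 1 - u ^ 3)); [exact (is_derive_cubF _ (Hz t Ht))|].
    auto_derive; [easy|]. reflexivity.
  + unfold f1, scal; simpl. unfold mult; simpl. ring.
- intros t Ht. evar_last.
  + apply @is_derive_mult.
    * instantiate (1 := - 6 / (1 + 2 * t) ^ 2). auto_derive; [lra|]. field. lra.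
    * apply (is_derive_comp cubF (fun u => cubic_moebius u ^ 3));
        [exact (is_derive_cubF _ (Hy t Ht))|apply is_derive_moebius_cube; lra].
    * intros; apply Rmult_comm.
  + unfold g1, plus, scal, mult; simpl. unfold mult; simpl. field. lra.
- intros t Ht. pose proof (is_derive_cubF_sl _ (Hz t Ht)) as H.
  apply (is_derive_ext_R
    (fun t => - 3 * ((fun z => z * (1 - z) * cubF1 z) (1 - t ^ 3)))).
  { intros u. unfold f1. ring. }
  evar_last.
  + apply @is_derive_scal. apply (is_derive_comp (fun z => z * (1 - z) * cubF1 z)).
    * exact H.
    * auto_derive; [easy|]. reflexivity.
  + unfold f, scal; simpl. unfold mult; simpl. field.
- intros t Ht. pose proof (is_derive_cubF_sl _ (Hy t Ht)) as H.
  pose proof (is_derive_cubF _ (Hy t Ht)) as H0.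
  set (y := cubic_moebius) in *.
  pose proof (is_derive_moebius t ltac:(lra)) as Hy'. fold y in Hy'.
  pose proof (is_derive_moebius_cube t ltac:(lra)) as Hy3. fold y in Hy3.
  (* With $t(1-t^3) = (1+2t)^4\,y(1-y^3)/9$ the weighted derivative is regrouped so that $F'$ occurs
     only in $z(1-z)F'(z)$ at $z=y^3$, whose derivative is known to be $\frac29F$. *)
  apply (is_derive_ext_pos
    (fun u => - (2 / 3) * (1 + 2 * u) ^ 2 * (y u * (1 - y u ^ 3)) * cubF (y u ^ 3)
      - 3 * (1 + 2 * u) * ((fun z => z * (1 - z) * cubF1 z) (y u ^ 3)))).
  { lra. }
  { intros u Hu. unfold g1, y, cubic_moebius. field. lra. }
  pose proof (is_derive_comp _ _ _ _ _ H Hy3) as D1.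
  pose proof (is_derive_comp _ _ _ _ _ H0 Hy3) as D0.
  cbv beta in D1, D0.
  assert (D2 : is_derive (fun u => - (2 / 3) * (1 + 2 * u) ^ 2 * (y u * (1 - y u ^ 3))) t
     (- (8 / 3) * (1 + 2 * t) * (y t * (1 - y t ^ 3))
      + 2 * (1 - 4 * y t ^ 3))).
  { auto_derive; [repeat split; now exists (- 3 / (1 + 2 * t) ^ 2)|].
    rewrite (Derive_eq y _ _ Hy'). field. lra. }
  assert (D3 : is_derive (fun u => 3 * (1 + 2 * u)) t 6) by (auto_derive; [easy|ring]).
  evar_last.
  + apply @is_derive_minus; apply @is_derive_mult; try eassumption; intros; apply Rmult_comm.
  + unfold g. unfold minus, plus, opp, mult, scal; simpl. unfold mult; simpl.
    generalize (cubF (y t * (y t * (y t * 1)))) (cubF1 (y t * (y t * (y t * 1)))).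
    intros F F1. unfold y, cubic_moebius. field. lra.
- intros t Ht. assert (0 < t ^ 3 < 1) by (split; [apply pow_lt; lra|apply cube_bound; lra]).
  apply Rgt_not_eq, Rmult_lt_0_compat; lra.
- exact Hg.
- cbv beta. replace (1 - 1 ^ 3) with 0 by ring. ring.
Qed.

(** * Logarithmic singularities *)

Definition quadE := hypF (1 / 6) (1 / 3) (1 / 2).
Definition quadE1 := hypF1 (1 / 6) (1 / 3) (1 / 2).

(* Both sides solve [(z (1 - z) y')' = 2/9 y] and are even in [z - 1/2]. *)
Lemma cubF_even_part z :
  0 < z < 1 / 2 -> cubF z + cubF (1 - z) = 2 * cubF (1 / 2) * quadE ((1 - 2 * z) ^ 2).
Proof.
intros Hz.
assert (Hu : forall t, z <= t <= 1 / 2 -> 0 <= (1 - 2 * t) ^ 2 < 1).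
{ intros t Ht. split; [apply pow2_ge_0|]. simpl. nra. }
assert (Hu' : forall t, z <= t <= 1 / 2 -> Rabs ((1 - 2 * t) ^ 2) < 1).
{ intros t Ht. specialize (Hu t Ht). apply Rabs_lt_1_intro. lra. }
assert (H0 : forall t, z <= t <= 1 / 2 -> Rabs t < 1 /\ Rabs (1 - t) < 1).
{ intros t Ht. split; apply Rabs_lt_1_intro; lra. }
set (f := fun t => cubF t + cubF (1 - t)).
set (f1 := fun t => cubF1 t - cubF1 (1 - t)).
set (g := fun t => quadE ((1 - 2 * t) ^ 2)).
set (g1 := fun t => - 4 * (1 - 2 * t) * quadE1 ((1 - 2 * t) ^ 2)).
assert (Hg : forall t, z <= t <= 1 / 2 -> 1 <= g t).
{ intros t Ht. apply hypF_ge_1; [apply hyp_ok_E|now apply Hu]. }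
assert (Hsq : forall t : R, is_derive (fun u => (1 - 2 * u) ^ 2) t (- 4 * (1 - 2 * t))).
{ intros t. auto_derive; [easy|ring]. }
assert (Hrefl : forall t : R, is_derive (fun u => 1 - u) t (- 1)).
{ intros t. auto_derive; [easy|ring]. }
enough (H : f z / g z = f (1 / 2) / g (1 / 2)).
{ assert (E : g (1 / 2) = 1).
  { unfold g. replace ((1 - 2 * (1 / 2)) ^ 2) with 0 by field. apply hypF_0. }
  rewrite E in H. specialize (Hg z ltac:(lra)).
  assert (E2 : f (1 / 2) = 2 * cubF (1 / 2)).
  { unfold f. replace (1 - 1 / 2) with (1 / 2) by field. ring. }
  change (f z = 2 * cubF (1 / 2) * g z). rewrite <- E2.
  apply (Rmult_eq_reg_r (/ g z)); [|apply Rinv_neq_0_compat; lra].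
  rewrite Rmult_assoc, Rinv_r by lra. unfold Rdiv in H at 1. rewrite H. field. }
apply (sturm_liouville_proportional (fun t => t * (1 - t)) (fun _ => 2 / 9) f f1 g g1).
- lra.
- intros t Ht. destruct (H0 t Ht) as [A B]. evar_last.
  + apply @is_derive_plus; [exact (is_derive_cubF _ A)|].
    apply (is_derive_comp cubF (fun u => 1 - u)); [exact (is_derive_cubF _ B)|apply Hrefl].
  + unfold f1, plus, scal; simpl. unfold mult; simpl. ring.
- intros t Ht. evar_last.
  + apply (is_derive_comp quadE (fun u => (1 - 2 * u) ^ 2)); [|apply Hsq].
    exact (is_derive_hypF _ _ _ _ hyp_ok_E (Hu' t Ht)).
  + unfold g1, scal; simpl. unfold mult; simpl. unfold quadE1. ring.
- intros t Ht. destruct (H0 t Ht) as [A B].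
  apply (is_derive_ext_R (fun t => (fun z => z * (1 - z) * cubF1 z) t
     - (fun z => z * (1 - z) * cubF1 z) (1 - t))).
  { intros u. unfold f1. ring. }
  evar_last.
  + apply @is_derive_minus; [exact (is_derive_cubF_sl _ A)|].
    apply (is_derive_comp (fun z => z * (1 - z) * cubF1 z) (fun u => 1 - u));
      [exact (is_derive_cubF_sl _ B)|apply Hrefl].
  + unfold f, minus, plus, opp, scal; simpl. unfold mult; simpl. ring.
- intros t Ht.
  (* Since $4t(1-t) = 1-(1-2t)^2$, the weight becomes the factor $1-u$, $u=(1-2t)^2$, of the
     hypergeometric equation for [quadE] at $u$. *)
  apply (is_derive_ext_R (fun t => - (1 - 2 * t) * (1 - (1 - 2 * t) ^ 2) *
     quadE1 ((1 - 2 * t) ^ 2))).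
  { intros u. unfold g1. ring. }
  pose proof (is_derive_comp _ _ _ _ _
    (is_derive_hypF1 _ _ _ _ hyp_ok_E (Hu' t Ht)) (Hsq t)) as D.
  pose proof (hyp_ode _ _ _ _ hyp_ok_E (Hu' t Ht)) as E. fold quadE quadE1 in D, E.
  assert (D2 : is_derive (fun t => - (1 - 2 * t) * (1 - (1 - 2 * t) ^ 2)) t
    (2 - 6 * (1 - 2 * t) ^ 2)) by (auto_derive; [easy|ring]).
  evar_last.
  + apply @is_derive_mult; [exact D2|exact D|intros; apply Rmult_comm].
  + unfold g, plus, scal, mult; simpl. unfold mult; simpl. simpl in E. nra.
- intros t Ht. apply Rgt_not_eq, Rmult_lt_0_compat; lra.
- intros t Ht. specialize (Hg t Ht). lra.
- unfold f1, g1. replace (1 - 1 / 2) with (1 / 2) by field.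
  replace (1 - 2 * (1 / 2)) with 0 by field. ring.
Qed.

Lemma inv_INR_bound n : 0 <= / INR n <= 1.
Proof.
destruct n as [|n].
- simpl. rewrite Rinv_0. lra.
- assert (1 <= INR (S n)) by (rewrite S_INR; pose proof (pos_INR n); lra).
  split; [left; apply Rinv_0_lt_compat; lra|].
  rewrite <- Rinv_1. apply Rinv_le_contravar; lra.
Qed.

(* The coefficient at [0] is the junk value [/ 0 = 0]. *)
Lemma is_pseries_log x : 0 <= x < 1 -> is_pseries (fun n => / INR n) x (- ln (1 - x)).
Proof.
intros Hx. set (a := fun n => / INR n).
assert (Hr : forall t, Rabs t < 1 -> Rbar_lt (Rabs t) (CV_radius a)).
{ intros t Ht. apply Rbar_lt_le_trans with (Finite 1); [exact Ht|].
  apply CV_radius_bounded. exists 1. intros n. rewrite pow1, Rmult_1_r.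
  pose proof (inv_INR_bound n). unfold a. rewrite Rabs_pos_eq; lra. }
assert (Hd : forall t, 0 <= t < 1 -> is_derive (PSeries a) t (/ (1 - t))).
{ intros t Ht. assert (Ht1 : Rabs t < 1) by (apply Rabs_lt_1_intro; lra).
  evar_last; [apply is_derive_PSeries; now apply Hr|].
  rewrite (PSeries_ext _ (fun _ => 1)).
  - unfold PSeries. rewrite (Series_ext _ (fun n => t ^ n)) by (intros; apply Rmult_1_l).
    now rewrite Series_geom.
  - intros n. unfold PS_derive, a. apply Rinv_r. apply not_0_INR. lia. }
replace (- ln (1 - x)) with (PSeries a x).
{ apply PSeries_correct, CV_radius_inside, Hr, Rabs_lt_1_intro. lra. }
destruct (proj1 Hx) as [Hp| <-].
- assert (E : PSeries a 0 + ln (1 - 0) = PSeries a x + ln (1 - x)).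
  { apply (eq_is_derive (fun t => PSeries a t + ln (1 - t))); [|easy].
    intros t Ht. evar_last.
    - apply @is_derive_plus; [apply Hd; lra|].
      instantiate (1 := - / (1 - t)). auto_derive; [lra|]. field. lra.
    - unfold plus, zero; simpl. ring. }
  rewrite PSeries_0, Rminus_0_r, ln_1 in E. unfold a in E at 1. simpl in E.
  rewrite Rinv_0 in E. lra.
- rewrite PSeries_0, Rminus_0_r, ln_1. unfold a. simpl. rewrite Rinv_0. ring.
Qed.

Lemma is_series_zero : is_series (fun _ : nat => 0) 0.
Proof.
change (is_lim_seq (sum_n (fun _ => 0)) 0).
apply (is_lim_seq_ext (fun _ => 0)); [|apply is_lim_seq_const].
intros n. rewrite sum_n_const. ring.
Qed.

Lemma ex_series_finite_support (M : nat -> R) N :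
  (forall n, (N < n)%nat -> M n = 0) -> ex_series M.
Proof.
intros H. apply (ex_series_incr_n M (S N)).
apply (ex_series_ext (fun _ => 0)).
- intros n. symmetry. apply H. lia.
- exists 0. apply is_series_zero.
Qed.

(** An Abelian argument: $c_n - L/n$ is at most $\varepsilon/n$ in absolute value beyond some index,
    and the finitely many earlier terms are absorbed in $K$, uniformly in $x$. *)
Lemma pseries_log_bound (c : nat -> R) (L eps : R) :
  (forall x, 0 <= x < 1 -> ex_pseries c x) ->
  is_lim_seq (fun n => INR n * c n) L -> 0 < eps ->
  exists K, forall x, 0 <= x < 1 ->
    Rabs (PSeries c x - L * - ln (1 - x)) <= K + eps * - ln (1 - x).
Proof.
intros Hex HL Heps.
apply is_lim_seq_spec in HL. destruct (HL (mkposreal eps Heps)) as [N HN]. simpl in HN.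
set (d := fun n => 1 * c n + - L * / INR n).
set (M := fun n => if le_lt_dec n N then Rabs (d n) else 0).
assert (HM : ex_series M).
{ apply (ex_series_finite_support M N). intros n Hn. unfold M.
  destruct (le_lt_dec n N); [lia|easy]. }
assert (HM0 : forall n, 0 <= M n).
{ intros n. unfold M. destruct (le_lt_dec n N); [apply Rabs_pos|lra]. }
assert (Hd : forall n, Rabs (d n) <= M n + eps * / INR n).
{ intros n. pose proof (inv_INR_bound n). unfold M. destruct (le_lt_dec n N) as [Hn|Hn].
  - nra.
  - assert (Hp : 0 < INR n) by (apply lt_0_INR; lia).
    specialize (HN n ltac:(lia)). rewrite Rplus_0_l.
    replace (d n) with ((INR n * c n - L) * / INR n) by (unfold d; field; lra).
    rewrite Rabs_mult, (Rabs_pos_eq (/ INR n)) by lra.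
    apply Rmult_le_compat_r; lra. }
exists (Series M). intros x Hx.
pose proof (is_pseries_log x Hx) as Hlog.
pose proof (is_pseries_lin _ _ _ _ _ 1 (- L) (PSeries_correct _ _ (Hex x Hx)) Hlog) as Hdx.
assert (E : PSeries d x = PSeries c x - L * - ln (1 - x)).
{ apply is_pseries_unique in Hdx. fold d in Hdx. rewrite Hdx. ring. }
rewrite <- E.
apply is_pseries_R in Hlog.
assert (Hb : is_series (fun n => M n + eps * (/ INR n * x ^ n)) (Series M + eps * - ln (1 - x))).
{ apply (is_series_plus M (fun n => eps * (/ INR n * x ^ n)) (Series M) (eps * - ln (1 - x))).
  - now apply Series_correct.
  - now apply (is_series_scal_l eps (fun n => / INR n * x ^ n)). }
assert (Hle : forall n, 0 <= Rabs (d n * x ^ n) <= M n + eps * (/ INR n * x ^ n)).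
{ intros n. split; [apply Rabs_pos|].
  assert (Hxn : 0 <= x ^ n <= 1).
  { split; [apply pow_le; lra|]. rewrite <- (pow1 n). apply pow_incr. lra. }
  rewrite Rabs_mult, (Rabs_pos_eq (x ^ n)) by lra.
  apply Rle_trans with ((M n + eps * / INR n) * x ^ n).
  - apply Rmult_le_compat_r; [lra|apply Hd].
  - specialize (HM0 n). nra. }
apply Rle_trans with (Series (fun n => Rabs (d n * x ^ n))).
- apply Series_Rabs. apply (@ex_series_le R_AbsRing R_CompleteNormedModule _
    (fun n => M n + eps * (/ INR n * x ^ n))).
  + intros n. unfold norm; simpl. unfold abs; simpl.
    rewrite Rabs_Rabsolu. apply Hle.
  + eexists; exact Hb.
- rewrite <- (is_series_unique _ _ Hb). apply Series_le; [exact Hle|].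
  eexists; exact Hb.
Qed.

Lemma pseries_log_equiv (c : nat -> R) (L : R) (x : nat -> R) :
  (forall x, 0 <= x < 1 -> ex_pseries c x) ->
  is_lim_seq (fun n => INR n * c n) L ->
  (forall n, 0 <= x n < 1) ->
  is_lim_seq (fun n => - ln (1 - x n)) p_infty ->
  is_lim_seq (fun n => PSeries c (x n) / - ln (1 - x n)) L.
Proof.
intros Hex HL Hx Hinf. apply is_lim_seq_spec. intros eps.
destruct (pseries_log_bound c L (eps / 2) Hex HL) as [K HK].
{ destruct eps; simpl; lra. }
apply is_lim_seq_spec in Hinf.
destruct (Hinf (Rmax 1 (2 * K / eps))) as [N HN].
exists N. intros n Hn. specialize (HN n Hn). specialize (HK (x n) (Hx n)).
set (t := - ln (1 - x n)) in *.
pose proof (Rmax_l 1 (2 * K / eps)). pose proof (Rmax_r 1 (2 * K / eps)).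
destruct eps as [e He]; simpl in *.
assert (K < e / 2 * t).
{ apply (Rmult_lt_reg_r (2 / e)); [apply Rdiv_lt_0_compat; lra|].
  replace (e / 2 * t * (2 / e)) with t by (field; lra).
  replace (K * (2 / e)) with (2 * K / e) by (field; lra). lra. }
replace (PSeries c (x n) / t - L) with ((PSeries c (x n) - L * t) / t) by (field; lra).
rewrite Rabs_div, (Rabs_pos_eq t) by lra.
apply (Rmult_lt_reg_r t); [lra|]. unfold Rdiv. rewrite Rmult_assoc, Rinv_l by lra. lra.
Qed.

(** * The sine product at 1/3 *)

(** Integrals behind Euler's product for the sine. Their recursion in $m$ contains $(2m+2)^2-a^2$,
    which at $a = 2/3$ is $4(m+2/3)(m+4/3)$: the factors of the rising factorials of $2/3$ and,
    shifted by one, of $1/3$. *)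
Definition wallis (a : R) (m : nat) : R :=
  RInt (fun t => cos (a * t) * cos t ^ (2 * m)) 0 (PI / 2).

Lemma ex_RInt_derivable (f : R -> R) (a b : R) : (forall x, ex_derive f x) -> ex_RInt f a b.
Proof.
intros H. apply (ex_RInt_continuous f). intros x _. now apply (ex_derive_continuous f).
Qed.

Lemma is_RInt_wallis a m :
  is_RInt (fun t => cos (a * t) * cos t ^ (2 * m)) 0 (PI / 2) (wallis a m).
Proof.
apply (RInt_correct (fun t => cos (a * t) * cos t ^ (2 * m))).
apply ex_RInt_derivable. intros x. auto_derive. easy.
Qed.

Lemma is_RInt_lin (f g : R -> R) (a b u v lf lg : R) :
  is_RInt f a b lf -> is_RInt g a b lg ->
  is_RInt (fun x => u * f x + v * g x) a b (u * lf + v * lg).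
Proof.
intros Hf Hg.
apply (is_RInt_plus (fun x => u * f x) (fun x => v * g x) a b (u * lf) (v * lg)).
- now apply (is_RInt_scal f a b u lf).
- now apply (is_RInt_scal g a b v lg).
Qed.

(** Two integrations by parts packed into one primitive. For even $k$ it vanishes at $0$ through the
    sines and at $\pi/2$ through the powers of the cosine, so integration yields the recursion. *)
Lemma is_derive_wallis_prim (a : R) (k : nat) (t : R) :
  is_derive (fun t => (INR k + 2) * cos t ^ (k + 1) * sin t * cos (a * t)
      - a * cos t ^ (k + 2) * sin (a * t)) t
    (((INR k + 2) ^ 2 - a ^ 2) * (cos (a * t) * cos t ^ (k + 2))
      + - ((INR k + 2) * (INR k + 1)) * (cos (a * t) * cos t ^ k)).
Proof.
auto_derive; [easy|].
replace (Init.Nat.pred (k + 1)) with k by lia.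
replace (Init.Nat.pred (k + 2)) with (k + 1)%nat by lia.
rewrite !plus_INR, !pow_add. simpl (INR 1). simpl (INR 2).
assert (Hs : sin t * sin t = 1 - cos t * cos t)
  by (pose proof (sin2_cos2 t); unfold Rsqr in *; lra).
transitivity (cos (a * t) * cos t ^ k *
  (- (INR k + 2) * (INR k + 1) * (sin t * sin t) + (INR k + 2) * cos t ^ 2 - a ^ 2 * cos t ^ 2)).
- ring.
- rewrite Hs. ring.
Qed.

Lemma wallis_rec a m :
  ((2 * INR m + 2) ^ 2 - a ^ 2) * wallis a (S m) =
  (2 * INR m + 2) * (2 * INR m + 1) * wallis a m.
Proof.
set (N := 2 * INR m + 2).
set (G := fun t => N * cos t ^ (2 * m + 1) * sin t * cos (a * t)
  - a * cos t ^ (2 * m + 2) * sin (a * t)).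
set (h := fun t => (N ^ 2 - a ^ 2) * (cos (a * t) * cos t ^ (2 * S m))
  + - (N * (N - 1)) * (cos (a * t) * cos t ^ (2 * m))).
assert (HG : forall t, is_derive G t (h t)).
{ intros t. pose proof (is_derive_wallis_prim a (2 * m) t) as D.
  rewrite mult_INR in D. unfold G, h. replace (2 * S m)%nat with (2 * m + 2)%nat by lia.
  replace (N - 1) with (INR 2 * INR m + 1) by (unfold N; simpl; ring). exact D. }
assert (I1 : is_RInt h 0 (PI / 2) (minus (G (PI / 2)) (G 0))).
{ apply (is_RInt_derive G h).
  - intros t _. apply HG.
  - intros t _. apply (ex_derive_continuous h). unfold h. auto_derive. easy. }
pose proof (is_RInt_lin _ _ _ _ (N ^ 2 - a ^ 2) (- (N * (N - 1))) _ _
  (is_RInt_wallis a (S m)) (is_RInt_wallis a m)) as I2.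
change (is_RInt h 0 (PI / 2) ((N ^ 2 - a ^ 2) * wallis a (S m)
  + - (N * (N - 1)) * wallis a m)) in I2.
assert (E : (N ^ 2 - a ^ 2) * wallis a (S m) + - (N * (N - 1)) * wallis a m
  = minus (G (PI / 2)) (G 0)).
{ rewrite <- (is_RInt_unique _ _ _ _ I1). symmetry. now apply is_RInt_unique. }
replace (minus (G (PI / 2)) (G 0)) with 0 in E.
- replace (2 * INR m + 1) with (N - 1) by (unfold N; ring). lra.
- unfold G, minus, plus, opp; simpl. replace (a * 0) with 0 by ring.
  rewrite sin_0, cos_PI2, !pow_i by lia. ring.
Qed.

Lemma wallis_0_0 : wallis 0 0 = PI / 2.
Proof.
unfold wallis. rewrite (RInt_ext _ (fun _ => 1)).
- rewrite RInt_const. unfold scal; simpl. unfold mult; simpl. ring.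
- intros x _. rewrite Rmult_0_l, cos_0. simpl. ring.
Qed.

Lemma wallis_0 a : a <> 0 -> wallis a 0 = sin (a * (PI / 2)) / a.
Proof.
intros Ha. apply is_RInt_unique.
replace (sin (a * (PI / 2)) / a)
  with (minus ((fun t => sin (a * t) / a) (PI / 2)) ((fun t => sin (a * t) / a) 0)).
- apply (is_RInt_derive (fun t => sin (a * t) / a)).
  + intros t _. auto_derive; [easy|]. simpl. field. easy.
  + intros t _. apply (ex_derive_continuous (fun t => cos (a * t) * cos t ^ (2 * 0))).
    auto_derive. easy.
- unfold minus, plus, opp; simpl. rewrite Rmult_0_r, sin_0. field. easy.
Qed.

Lemma wallis_pos m : 0 < wallis 0 m.
Proof.
induction m as [|m IH].
- rewrite wallis_0_0. pose proof PI_RGT_0. lra.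
- pose proof (wallis_rec 0 m) as H. pose proof (pos_INR m).
  set (n := INR m) in *.
  apply (Rmult_lt_reg_l ((2 * n + 2) ^ 2 - 0 ^ 2)); [nra|].
  rewrite H, Rmult_0_r. apply Rmult_lt_0_compat; nra.
Qed.

Lemma cos_ge_quadratic x : 0 <= x <= PI -> 1 - x ^ 2 / 2 <= cos x.
Proof.
intros Hx. assert (H : 0 <= sin (x / 2) <= x / 2).
{ split; [apply sin_ge_0; lra|].
  destruct (proj1 Hx) as [Hp| <-]; [left; apply sin_lt_x; lra|].
  replace (0 / 2) with 0 by field. rewrite sin_0. lra. }
replace x with (2 * (x / 2)) at 2 by field. rewrite cos_2a_sin. nra.
Qed.

Lemma mul_cos_le_sin t : 0 <= t <= PI -> t * cos t <= sin t.
Proof.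
intros [[Hp| <-] Ht]; [|rewrite sin_0; lra].
destruct (MVT_gen (fun u => sin u - u * cos u) 0 t (fun u => u * sin u)) as [c [Hc E]];
  rewrite ?Rmin_left, ?Rmax_right in * by lra.
- intros u _. auto_derive; [easy|ring].
- intros u _. apply continuity_pt_filterlim.
  apply (ex_derive_continuous (fun u => sin u - u * cos u)). auto_derive. easy.
- rewrite sin_0 in E. assert (0 <= c * sin c).
  { apply Rmult_le_pos; [|apply sin_ge_0]; lra. }
  nra.
Qed.

(** The error $1-\cos(at) \le a^2t^2/2$ is traded for a difference of consecutive integrals by
    $t\cos t \le \sin t$, i.e. $t^2\cos^2t \le 1-\cos^2t$. *)
Lemma wallis_ratio_bound a m :
  0 <= a <= 1 ->
  0 <= wallis 0 (S m) - wallis a (S m) <= a ^ 2 / 2 * (wallis 0 m - wallis 0 (S m)).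
Proof.
intros Ha. pose proof PI_RGT_0 as Hpi.
pose proof (is_RInt_lin _ _ _ _ 1 (-1) _ _ (is_RInt_wallis 0 (S m)) (is_RInt_wallis a (S m))) as I1.
pose proof (is_RInt_lin _ _ _ _ (a ^ 2 / 2) (- (a ^ 2 / 2)) _ _
  (is_RInt_wallis 0 m) (is_RInt_wallis 0 (S m))) as I2.
assert (Hc : forall t, 0 < t < PI / 2 ->
  0 <= 1 - cos (a * t) <= a ^ 2 / 2 * t ^ 2 /\ 0 <= cos t ^ (2 * m) /\
  t ^ 2 * cos t ^ 2 <= 1 - cos t ^ 2).
{ intros t Ht. assert (0 <= a * t <= PI) by nra.
  pose proof (cos_ge_quadratic (a * t) ltac:(lra)). pose proof (COS_bound (a * t)).
  pose proof (cos_gt_0 t ltac:(lra) ltac:(lra)).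
  pose proof (mul_cos_le_sin t ltac:(lra)). pose proof (sin2_cos2 t). unfold Rsqr in *.
  split; [|split].
  - simpl in *. nra.
  - apply pow_le. lra.
  - assert (0 <= t * cos t) by nra. simpl. nra. }
assert (H2 : forall t, (2 * S m)%nat = (2 * m + 2)%nat /\
  cos t ^ (2 * m + 2) = cos t ^ (2 * m) * cos t ^ 2).
{ intros t. split; [lia|apply pow_add]. }
split.
- replace (wallis 0 (S m) - wallis a (S m))
    with (1 * wallis 0 (S m) + -1 * wallis a (S m)) by ring.
  replace 0 with (scal (PI / 2 - 0) 0) at 1 by apply Rmult_0_r.
  apply (is_RInt_le (fun _ => 0) _ 0 (PI / 2) _ _ ltac:(lra) (is_RInt_const 0 (PI / 2) 0) I1).
  intros t Ht. destruct (Hc t Ht) as [A [B _]]. destruct (H2 t) as [-> ->].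
  rewrite Rmult_0_l, cos_0. pose proof (Rmult_le_pos _ _ B (pow2_ge_0 (cos t))) as D.
  pose proof (Rmult_le_pos _ _ (proj1 A) D). lra.
- replace (wallis 0 (S m) - wallis a (S m))
    with (1 * wallis 0 (S m) + -1 * wallis a (S m)) by ring.
  replace (a ^ 2 / 2 * (wallis 0 m - wallis 0 (S m)))
    with (a ^ 2 / 2 * wallis 0 m + - (a ^ 2 / 2) * wallis 0 (S m)) by ring.
  apply (is_RInt_le _ _ 0 (PI / 2) _ _ ltac:(lra) I1 I2).
  intros t Ht. destruct (Hc t Ht) as [A [B C]]. destruct (H2 t) as [-> ->].
  rewrite Rmult_0_l, cos_0. pose proof (pow2_ge_0 (cos t)). pose proof (pow2_ge_0 a).
  replace (1 * (1 * (cos t ^ (2 * m) * cos t ^ 2)) + 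
      -1 * (cos (a * t) * (cos t ^ (2 * m) * cos t ^ 2)))
    with (cos t ^ (2 * m) * ((1 - cos (a * t)) * cos t ^ 2)) by ring.
  replace (a ^ 2 / 2 * (1 * cos t ^ (2 * m)) + - (a ^ 2 / 2) * (1 * (cos t ^ (2 * m) * cos t ^ 2)))
    with (cos t ^ (2 * m) * (a ^ 2 / 2 * (1 - cos t ^ 2))) by ring.
  apply Rmult_le_compat_l; [easy|].
  apply Rle_trans with (a ^ 2 / 2 * t ^ 2 * cos t ^ 2); [apply Rmult_le_compat_r; lra|].
  rewrite Rmult_assoc. apply Rmult_le_compat_l; lra.
Qed.

(** The recursions at $a=2/3$ and $a=0$ telescope against the one for the coefficients; the factor
    $m+1/3$ is the shift in the rising factorial of $1/3$. *)
Lemma hyp_wallis m :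
  3 * (INR m + 1 / 3) * hyp (1 / 3) (2 / 3) 1 m * wallis (2 / 3) m * (PI / 2)
  = wallis (2 / 3) 0 * wallis 0 m.
Proof.
induction m as [|m IH].
- rewrite wallis_0_0. unfold hyp; simpl. field.
- pose proof (wallis_rec 0 m) as H0. pose proof (wallis_rec (2 / 3) m) as H1.
  pose proof (hyp_S (1 / 3) (2 / 3) 1 m ltac:(lra)) as H2.
  pose proof (pos_INR m) as Hm. rewrite S_INR.
  set (n := INR m) in *. set (P := PI / 2) in *.
  set (N := (2 * n + 2) * (2 * n + 1)) in *.
  replace (wallis 0 (S m)) with (N * wallis 0 m / (2 * n + 2) ^ 2)
    by (rewrite <- H0; field; nra).
  replace (wallis (2 / 3) (S m)) with (N * wallis (2 / 3) m / ((2 * n + 2) ^ 2 - (2 / 3) ^ 2))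
    by (rewrite <- H1; field; nra).
  replace (hyp (1 / 3) (2 / 3) 1 (S m))
    with (hyp (1 / 3) (2 / 3) 1 m * ((1 / 3 + n) * (2 / 3 + n)) / ((1 + n) * (1 + n)))
    by (rewrite <- H2; field; nra).
  replace (wallis (2 / 3) 0 * (N * wallis 0 m / (2 * n + 2) ^ 2))
    with (wallis (2 / 3) 0 * wallis 0 m * N / (2 * n + 2) ^ 2) by (field; nra).
  rewrite <- IH. field. nra.
Qed.

Lemma is_lim_seq_inv_INR (k : R) : is_lim_seq (fun n => k / INR n) 0.
Proof.
replace (Finite 0) with (Rbar_mult k (Rbar_inv p_infty)) by (simpl; f_equal; ring).
apply (is_lim_seq_scal_l (fun n => / INR n) k).
apply is_lim_seq_inv; [apply is_lim_seq_INR|easy].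
Qed.

Lemma wallis_ratio_lim a :
  0 <= a <= 1 -> is_lim_seq (fun m => wallis a m / wallis 0 m) 1.
Proof.
intros Ha. apply is_lim_seq_incr_1.
apply (is_lim_seq_le_le_loc (fun m => 1 - 1 / INR m) _ (fun _ => 1)).
- exists 1%nat. intros m Hm. apply le_INR in Hm. simpl in Hm.
  pose proof (wallis_pos (S m)) as Hp. pose proof (wallis_rec 0 m) as H0.
  pose proof (wallis_ratio_bound a m Ha) as [B1 B2].
  set (n := INR m) in *.
  (* At $a=0$ the recursion reads $(2m+2)W_{m+1} = (2m+1)W_m$, so the error bound is $O(1/m)$
     relative to $W_{m+1}$. *)
  assert (E : wallis 0 m - wallis 0 (S m) = wallis 0 (S m) / (2 * n + 1)).
  { replace (wallis 0 m) with (wallis 0 (S m) * (2 * n + 2) / (2 * n + 1)); [field; lra|].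
    apply (Rmult_eq_reg_l ((2 * n + 2) * (2 * n + 1))); [|nra]. rewrite <- H0. field. lra. }
  rewrite E in B2. set (w := wallis 0 (S m)) in *. set (v := wallis a (S m)) in *.
  assert (B3 : a ^ 2 / 2 * (w / (2 * n + 1)) <= w * (1 / n)).
  { replace (a ^ 2 / 2 * (w / (2 * n + 1))) with (w * (a ^ 2 / (2 * (2 * n + 1)))) by (field; lra).
    apply Rmult_le_compat_l; [lra|]. apply Rmult_le_reg_r with (n * (2 * (2 * n + 1))); [nra|].
    replace (a ^ 2 / (2 * (2 * n + 1)) * (n * (2 * (2 * n + 1)))) with (a ^ 2 * n) by (field; lra).
    replace (1 / n * (n * (2 * (2 * n + 1)))) with (2 * (2 * n + 1)) by (field; lra).
    assert (a ^ 2 <= 1) by (simpl; nra). nra. }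
  split; (apply (Rmult_le_reg_r w); [lra|]); replace (v / w * w) with v by (field; lra); lra.
- replace (Finite 1) with (Rbar_minus 1 0) by (simpl; f_equal; ring).
  apply is_lim_seq_minus'; [apply is_lim_seq_const|apply is_lim_seq_inv_INR].
- apply is_lim_seq_const.
Qed.

Lemma wallis_two_thirds_0 : wallis (2 / 3) 0 / (PI / 2) = 3 * (sqrt 3 / (2 * PI)).
Proof.
rewrite wallis_0 by lra. replace (2 / 3 * (PI / 2)) with (PI / 3) by field.
rewrite sin_PI3. pose proof PI_RGT_0. field. lra.
Qed.

(** The limit is $1/(\Gamma(1/3)\Gamma(2/3))$, reached directly in terms of $\pi$: the Wallis
    quotient tends to 1, and only $\sin(\pi/3)$ from the integral at $m=0$ remains. *)
Lemma hyp_F_equiv : is_lim_seq (fun n => INR n * hyp (1 / 3) (2 / 3) 1 n) (sqrt 3 / (2 * PI)).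
Proof.
pose proof (wallis_ratio_lim (2 / 3) ltac:(lra)) as H.
set (rho := 3 * (sqrt 3 / (2 * PI))).
apply (is_lim_seq_ext_loc (fun n => rho / (wallis (2 / 3) n / wallis 0 n) / (3 + 1 / INR n))).
- exists 1%nat. intros n Hn. apply le_INR in Hn. simpl in Hn.
  pose proof (hyp_wallis n) as E. pose proof (wallis_pos n) as Hp. pose proof PI_RGT_0 as Hpi.
  assert (E2 : rho * wallis 0 n = 3 * (INR n + 1 / 3) * hyp (1 / 3) (2 / 3) 1 n * wallis (2 / 3) n).
  { unfold rho. rewrite <- wallis_two_thirds_0. apply (Rmult_eq_reg_r (PI / 2)); [|lra].
    rewrite E. field. lra. }
  assert (Hr : 0 < rho).
  { unfold rho. apply Rmult_lt_0_compat; [lra|]. apply Rdiv_lt_0_compat; [apply sqrt_lt_R0|]; lra. }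
  assert (Hw : wallis (2 / 3) n <> 0).
  { intros E0. rewrite E0, Rmult_0_r in E2. nra. }
  replace (rho / (wallis (2 / 3) n / wallis 0 n)) with (rho * wallis 0 n / wallis (2 / 3) n)
    by (field; lra).
  rewrite E2. field. repeat split; lra.
- replace (Finite (sqrt 3 / (2 * PI))) with (Finite (rho / 1 / (3 + 0)))
    by (unfold rho; f_equal; field; pose proof PI_RGT_0; lra).
  apply is_lim_seq_div'; [| |lra];
    [|apply is_lim_seq_plus'; [apply is_lim_seq_const|apply is_lim_seq_inv_INR]].
  apply is_lim_seq_div'; [apply is_lim_seq_const|exact H|lra].
Qed.

(** * Gamma at 1/3 and 2/3 *)

(** One third of $B((k+1)/3, n+1)$ after $t=v^3$. The substitution removes the fractional power, so
    that $k=0,1$ handle the arguments $1/3$ and $2/3$ with polynomial integrands. *)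
Definition cubic_beta (k n : nat) : R := RInt (fun v => v ^ k * (1 - v ^ 3) ^ n) 0 1.

Lemma is_RInt_cubic_beta k n :
  is_RInt (fun v => v ^ k * (1 - v ^ 3) ^ n) 0 1 (cubic_beta k n).
Proof.
apply (RInt_correct (fun v => v ^ k * (1 - v ^ 3) ^ n)).
apply ex_RInt_derivable. intros x. auto_derive. easy.
Qed.

Lemma cubic_beta_rec k n :
  (INR k + 1 + 3 * (INR n + 1)) * cubic_beta k (S n) = 3 * (INR n + 1) * cubic_beta k n.
Proof.
set (G := fun v : R => v ^ (k + 1) * (1 - v ^ 3) ^ (n + 1)).
set (h := fun v => (INR k + 1 + 3 * (INR n + 1)) * (v ^ k * (1 - v ^ 3) ^ (S n))
  + - (3 * (INR n + 1)) * (v ^ k * (1 - v ^ 3) ^ n)).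
assert (HG : forall v, is_derive G v (h v)).
{ intros v. unfold G, h. auto_derive; [easy|].
  replace (Init.Nat.pred (k + 1)) with k by lia.
  replace (Init.Nat.pred (n + 1)) with n by lia.
  rewrite !plus_INR, !pow_add. simpl (INR 1). simpl. unfold Rminus. 
  generalize ((1 + - (v * (v * (v * 1)))) ^ n). intros P. ring. }
assert (I1 : is_RInt h 0 1 (minus (G 1) (G 0))).
{ apply (is_RInt_derive G h).
  - intros t _. apply HG.
  - intros t _. apply (ex_derive_continuous h). unfold h. auto_derive. easy. }
pose proof (is_RInt_lin _ _ _ _ (INR k + 1 + 3 * (INR n + 1)) (- (3 * (INR n + 1))) _ _
  (is_RInt_cubic_beta k (S n)) (is_RInt_cubic_beta k n)) as I2.
change (is_RInt h 0 1 ((INR k + 1 + 3 * (INR n + 1)) * cubic_beta k (S n)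
  + - (3 * (INR n + 1)) * cubic_beta k n)) in I2.
apply (is_RInt_unique h) in I1. apply (is_RInt_unique h) in I2.
rewrite I1 in I2. unfold G, minus, plus, opp in I2; simpl in I2.
replace (1 - 1 * (1 * (1 * 1))) with 0 in I2 by ring.
rewrite !pow_i in I2 by lia. lra.
Qed.

Lemma cubic_beta_rising k n (s : R) :
  INR k + 1 = 3 * s -> cubic_beta k n = INR (fact n) / (3 * rising s (S n)).
Proof.
intros Hs. assert (Hp : 0 < s) by (pose proof (pos_INR k); lra).
induction n as [|n IH].
- unfold cubic_beta. apply is_RInt_unique.
  replace (INR (fact 0) / (3 * rising s 1))
    with (minus ((fun v => v ^ (S k) / (3 * s)) 1) ((fun v => v ^ (S k) / (3 * s)) 0)).
  + apply (is_RInt_derive (fun v => v ^ (S k) / (3 * s))).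
    * intros v _. auto_derive; [easy|].
      change (match k with O => 1 | S _ => INR k + 1 end) with (INR (S k)).
      rewrite S_INR, Hs. simpl. field. lra.
    * intros v _. apply (ex_derive_continuous (fun v => v ^ k * (1 - v ^ 3) ^ 0)).
      auto_derive. easy.
  + unfold minus, plus, opp; simpl. rewrite pow1. field. lra.
- pose proof (cubic_beta_rec k n) as H. pose proof (pos_INR n).
  pose proof (rising_pos s (S n) Hp). rewrite IH in H.
  change (rising s (S (S n))) with (rising s (S n) * (s + INR (S n))).
  rewrite fact_simpl, mult_INR, S_INR.
  apply (Rmult_eq_reg_l (INR k + 1 + 3 * (INR n + 1))); [|rewrite Hs; lra].
  rewrite H, Hs. field. lra.
Qed.

(** * The gamma integral after the substitution t = w^3 *)

Definition gam (k : nat) (x : R) : R := RInt (fun w => w ^ k * exp (- w ^ 3)) 0 x.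

Lemma is_RInt_gam k a b :
  is_RInt (fun w => w ^ k * exp (- w ^ 3)) a b (RInt (fun w => w ^ k * exp (- w ^ 3)) a b).
Proof.
apply (RInt_correct (fun w => w ^ k * exp (- w ^ 3))).
apply ex_RInt_derivable. intros x. auto_derive. easy.
Qed.

Lemma is_derive_gam k x : is_derive (gam k) x (x ^ k * exp (- x ^ 3)).
Proof.
apply (is_derive_RInt (fun w => w ^ k * exp (- w ^ 3)) (gam k) 0).
- apply filter_forall. intros t. apply is_RInt_gam.
- apply (ex_derive_continuous (fun w => w ^ k * exp (- w ^ 3))). auto_derive. easy.
Qed.

Lemma gam_0 k : gam k 0 = 0.
Proof. exact (RInt_point 0 (fun w => w ^ k * exp (- w ^ 3))). Qed.

Lemma gam_incr k x y : 0 <= x -> x < y -> gam k x < gam k y.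
Proof.
intros Hx Hxy.
assert (H : 0 < RInt (fun w => w ^ k * exp (- w ^ 3)) x y).
{ apply RInt_gt_0; [easy| |].
  - intros w Hw. apply Rmult_lt_0_compat; [apply pow_lt; lra|apply exp_pos].
  - intros w _. apply (ex_derive_continuous (fun w => w ^ k * exp (- w ^ 3))). auto_derive. easy. }
pose proof (RInt_Chasles (fun w => w ^ k * exp (- w ^ 3)) 0 x y
  (ex_intro _ _ (is_RInt_gam k 0 x)) (ex_intro _ _ (is_RInt_gam k x y))) as C.
change (gam k x + RInt (fun w => w ^ k * exp (- w ^ 3)) x y = gam k y) in C. lra.
Qed.

Lemma gam_le k x : (k <= 1)%nat -> 0 <= x -> gam k x <= exp 2.
Proof.
intros Hk Hx.
apply Rle_trans with (exp 2 * (1 - exp (- x))).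
- assert (I : is_RInt (fun w => exp 2 * exp (- w)) 0 x (exp 2 * (1 - exp (- x)))).
  { replace (exp 2 * (1 - exp (- x)))
      with (minus ((fun w => - exp 2 * exp (- w)) x) ((fun w => - exp 2 * exp (- w)) 0)).
    - apply (is_RInt_derive (fun w => - exp 2 * exp (- w))).
      + intros w _. auto_derive; [easy|ring].
      + intros w _. apply (ex_derive_continuous (fun w => exp 2 * exp (- w))). auto_derive. easy.
    - unfold minus, plus, opp; simpl. rewrite Ropp_0, exp_0. ring. }
  apply (is_RInt_le _ _ 0 x _ _ Hx (is_RInt_gam k 0 x) I).
  intros w Hw. rewrite <- exp_plus.
  assert (Hwk : w ^ k <= exp w).
  { pose proof (exp_ineq1 w ltac:(lra)).
    destruct k as [|[|k]]; [simpl|simpl|lia]; lra. }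
  apply Rle_trans with (exp w * exp (- w ^ 3)).
  + apply Rmult_le_compat_r; [left; apply exp_pos|easy].
  + rewrite <- exp_plus. apply exp_le_compat. simpl.
    (* This product is $w^3-3w+2$, hence $w-w^3 \le 2-2w \le 2-w$; this is the origin of the
       constant $e^2$. *)
    assert (0 <= (w - 1) ^ 2 * (w + 2)) by (apply Rmult_le_pos; [apply pow2_ge_0|lra]).
    simpl in *. nra.
- pose proof (exp_pos 2). pose proof (exp_pos (- x)). nra.
Qed.

Lemma gam_lim_ex k :
  (k <= 1)%nat -> exists g, 0 < g /\ filterlim (gam k) (Rbar_locally p_infty) (locally g).
Proof.
intros Hk.
destruct (completeness (fun y => exists x, 0 <= x /\ y = gam k x)) as [g [G1 G2]].
- exists (exp 2). intros y [x [Hx ->]]. now apply gam_le.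
- exists (gam k 0), 0. split; [lra|easy].
- exists g. split.
  + rewrite <- (gam_0 k). apply Rlt_le_trans with (gam k 1); [apply gam_incr; lra|].
    apply G1. exists 1. split; [lra|easy].
  + assert (H : is_lim (gam k) p_infty g); [|exact H]. apply is_lim_spec. intros eps.
    assert (Hx : exists x0, 0 <= x0 /\ g - eps < gam k x0).
    { apply Classical_Prop.NNPP. intros Hno.
      assert (g <= g - eps).
      { apply G2. intros y [x [Hx ->]]. apply Rnot_lt_le. intros H. apply Hno. eauto. }
      destruct eps as [e He]; simpl in *; lra. }
    destruct Hx as [x0 [Hx0 H0]]. exists x0. intros x Hx.
    assert (gam k x0 < gam k x) by (apply gam_incr; lra).
    assert (gam k x <= g) by (apply G1; exists x; split; [lra|easy]).
    apply Rabs_def1; lra.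
Qed.

Definition cbrt (t : R) : R := Rpower t (1 / 3).

Lemma cbrt_pos t : 0 < cbrt t.
Proof. apply exp_pos. Qed.

Lemma cbrt_cube t : 0 < t -> cbrt t ^ 3 = t.
Proof.
intros Ht. unfold cbrt. rewrite <- Rpower_pow by apply exp_pos.
rewrite Rpower_mult. replace (1 / 3 * INR 3) with 1 by (simpl; field). now apply Rpower_1.
Qed.

Lemma cbrt_pow t k : cbrt t ^ k = Rpower t (INR k / 3).
Proof.
unfold cbrt. rewrite <- Rpower_pow by apply exp_pos.
rewrite Rpower_mult. f_equal. field.
Qed.

Lemma cube_lt_inv x y : 0 < x -> 0 < y -> x ^ 3 < y ^ 3 -> x < y.
Proof.
intros Hx Hy H. apply Rnot_le_lt. intros Hyx.
assert (y ^ 3 <= x ^ 3) by (apply pow_incr; lra). lra.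
Qed.

Lemma filterlim_cbrt_0 : filterlim cbrt (at_right 0) (locally 0).
Proof.
apply filterlim_locally. intros [e He].
assert (He3 : 0 < e ^ 3) by (now apply pow_lt).
exists (mkposreal (e ^ 3) He3). intros t Ht Ht0.
unfold ball in *; simpl in *. unfold AbsRing_ball, abs, minus, plus, opp in *; simpl in *.
apply Rabs_def2 in Ht. pose proof (cbrt_pos t).
assert (cbrt t < e).
{ apply cube_lt_inv; [easy|easy|]. rewrite cbrt_cube by easy. simpl. lra. }
apply Rabs_def1; lra.
Qed.

Lemma filterlim_cbrt_infty : filterlim cbrt (Rbar_locally p_infty) (Rbar_locally p_infty).
Proof.
enough (H : is_lim cbrt p_infty p_infty) by exact H. apply is_lim_spec. intros M.
exists (Rmax M 1 ^ 3). intros t Ht. pose proof (Rmax_l M 1). pose proof (Rmax_r M 1).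
assert (0 < Rmax M 1 ^ 3) by (apply pow_lt; lra).
enough (Rmax M 1 < cbrt t) by lra.
apply cube_lt_inv; [lra|apply cbrt_pos|]. rewrite cbrt_cube; lra.
Qed.

Lemma is_derive_gam_cbrt k t : 0 < t ->
  is_derive (fun t => 3 * gam k (cbrt t)) t (Rpower t ((INR k + 1) / 3 - 1) * exp (- t)).
Proof.
intros Ht.
assert (Hc : is_derive cbrt t (1 / 3 * Rpower t (1 / 3 - 1))).
{ apply is_derive_Reals. apply derivable_pt_lim_power. easy. }
evar_last.
- apply @is_derive_scal. apply (is_derive_comp (gam k) cbrt); [apply is_derive_gam|exact Hc].
- unfold scal; simpl. unfold mult; simpl.
  change (cbrt t * (cbrt t * (cbrt t * 1))) with (cbrt t ^ 3).
  rewrite cbrt_cube, cbrt_pow by easy.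
  replace ((INR k + 1) / 3 - 1) with (INR k / 3 + (1 / 3 - 1)) by field.
  rewrite Rpower_plus. field.
Qed.

(** The change of variables is done by the fundamental theorem with the primitive
    $3\,$[gam k (cbrt t)], valid for $t>0$, so the improper integral is the difference of its limits
    at the two ends. *)
Lemma Gamma_gam k (g : R) : filterlim (gam k) (Rbar_locally p_infty) (locally g) ->
  Gamma ((INR k + 1) / 3) = 3 * g.
Proof.
intros Hg. unfold Gamma. set (s := (INR k + 1) / 3).
apply (@is_RInt_gen_unique R_CompleteNormedModule (at_right 0) (Rbar_locally p_infty) _ _).
set (Phi := fun t => 3 * gam k (cbrt t)).
assert (H0 : filterlim Phi (at_right 0) (locally 0)).
{ replace 0 with (3 * gam k 0) at 2 by (rewrite gam_0; ring).
  apply (filterlim_comp _ _ _ cbrt (fun x => 3 * gam k x) _ (locally 0)); [apply filterlim_cbrt_0|].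
  apply (ex_derive_continuous (fun x => 3 * gam k x)).
  eexists. apply @is_derive_scal. apply is_derive_gam. }
assert (H1 : filterlim Phi (Rbar_locally p_infty) (locally (3 * g))).
{ apply (filterlim_comp _ _ _ (fun t => gam k (cbrt t)) (fun x => 3 * x) _ (locally g)).
  - apply (filterlim_comp _ _ _ cbrt (gam k) _ (Rbar_locally p_infty));
      [apply filterlim_cbrt_infty|exact Hg].
  - apply (ex_derive_continuous (fun x => 3 * x)). auto_derive. easy. }
intros P HP.
assert (H2 : filterlim (fun ab => plus (Phi (snd ab)) (opp (Phi (fst ab))))
  (filter_prod (at_right 0) (Rbar_locally p_infty)) (locally (3 * g))).
{ replace (3 * g) with (minus (3 * g) 0) by (unfold minus, plus, opp; simpl; ring).
  apply (filterlim_comp_2 (G := locally (3 * g)) (H := locally (opp 0))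
    (fun ab => Phi (snd ab)) (fun ab => - Phi (fst ab)) Rplus).
  - apply (filterlim_comp (R * R) R R snd Phi _ (Rbar_locally p_infty));
      [apply filterlim_snd|exact H1].
  - apply (filterlim_comp (R * R) R R (fun ab => Phi (fst ab)) Ropp
      (filter_prod (at_right 0) (Rbar_locally p_infty)) (locally 0)).
    + apply (filterlim_comp (R * R) R R fst Phi _ (at_right 0)); [apply filterlim_fst|exact H0].
    + apply (filterlim_opp (V := R_NormedModule) 0).
  - apply (filterlim_plus (V := R_NormedModule) (3 * g) (opp 0)). }
specialize (H2 P HP).
assert (H3 : filter_prod (at_right 0) (Rbar_locally p_infty)
  (fun ab : R * R => 0 < fst ab /\ 0 < snd ab)).
{ apply (Filter_prod _ _ _ (fun a => 0 < a) (fun b => 0 < b)).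
  - exists (mkposreal 1 Rlt_0_1). intros y _ Hy. exact Hy.
  - exists 0. easy.
  - intros x y Hx Hy. easy. }
unfold filtermapi. unfold filtermap in H2.
generalize (filter_and _ _ H2 H3). apply filter_imp.
intros [a b] [HPab [Ha Hb]]. simpl in *.
exists (minus (Phi b) (Phi a)). split; [|exact HPab].
assert (Hpos : forall x, Rmin a b <= x <= Rmax a b -> 0 < x).
{ intros x Hx. apply Rlt_le_trans with (Rmin a b); [now apply Rmin_glb_lt|easy]. }
apply (is_RInt_derive Phi).
- intros x Hx. apply is_derive_gam_cbrt. auto.
- intros x Hx. specialize (Hpos x Hx).
  apply (ex_derive_continuous (fun t => Rpower t (s - 1) * exp (- t))).
  unfold Rpower. auto_derive. easy.
Qed.

Lemma bernoulli_ge y n : 0 <= y <= 1 -> 1 - INR n * y <= (1 - y) ^ n.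
Proof.
intros Hy. induction n as [|n IH]; [simpl; lra|].
rewrite S_INR. simpl. pose proof (pos_INR n).
assert ((1 - INR n * y) * (1 - y) <= (1 - y) * (1 - y) ^ n).
{ rewrite Rmult_comm. apply Rmult_le_compat_l; lra. }
nra.
Qed.

(** From $e^{-x}(1-x^2) \le 1-x$ and Bernoulli's inequality the defect is at most $nx^2e^{-nx}$;
    with $y=nx$ the bound $y^2e^{-y}\le4$ makes it at most $4/n$, uniformly in $x$. *)
Lemma pow_exp_bounds x n : (1 <= n)%nat -> 0 <= x <= 1 ->
  exp (- (INR n * x)) - 4 / INR n <= (1 - x) ^ n <= exp (- (INR n * x)).
Proof.
intros Hn Hx. apply le_INR in Hn. simpl in Hn.
assert (He : forall y, 1 + y <= exp y).
{ intros y. destruct (Req_dec y 0) as [-> |Hy]; [rewrite exp_0; lra|]. left. now apply exp_ineq1. }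
assert (En : exp (- (INR n * x)) = exp (- x) ^ n) by (rewrite exp_pow; f_equal; ring).
pose proof (exp_pos (- x)) as Hp. split.
- assert (L : exp (- x) * (1 - x ^ 2) <= 1 - x).
  { assert (exp (- x) * (1 + x) <= 1).
    { replace 1 with (exp (- x) * exp x) at 2 by (rewrite <- exp_plus, Rplus_opp_l; apply exp_0).
      apply Rmult_le_compat_l; [lra|apply He]. }
    replace (exp (- x) * (1 - x ^ 2)) with (exp (- x) * (1 + x) * (1 - x)) by (simpl; ring). nra. }
  assert (Hx2 : 0 <= x ^ 2 <= 1) by (simpl; nra).
  apply Rle_trans with ((exp (- x) * (1 - x ^ 2)) ^ n);
    [|apply pow_incr; split; [apply Rmult_le_pos; lra|easy]].
  rewrite Rpow_mult_distr, <- En.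
  apply Rle_trans with (exp (- (INR n * x)) * (1 - INR n * x ^ 2)).
  + enough (exp (- (INR n * x)) * (INR n * x ^ 2) <= 4 / INR n) by lra.
    set (y := INR n * x). assert (Hy : 0 <= y) by (unfold y; nra).
    apply (Rmult_le_reg_r (INR n)); [lra|].
    replace (exp (- y) * (INR n * x ^ 2) * INR n) with (exp (- y) * y ^ 2)
      by (unfold y; simpl; ring).
    replace (4 / INR n * INR n) with 4 by (field; lra).
    assert (Q : y ^ 2 / 4 <= exp y).
    { replace (exp y) with (exp (y / 2) * exp (y / 2)) by (rewrite <- exp_plus; f_equal; field).
      pose proof (He (y / 2)). simpl. nra. }
    replace 4 with (4 * (exp (- y) * exp y)).
    * pose proof (exp_pos (- y)). nra.
    * rewrite <- exp_plus, Rplus_opp_l, exp_0. ring.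
  + apply Rmult_le_compat_l; [left; apply exp_pos|]. now apply bernoulli_ge.
- rewrite En. apply pow_incr. pose proof (He (- x)). lra.
Qed.

Lemma gam_scale k l : gam k l = l ^ (k + 1) * RInt (fun v => v ^ k * exp (- (l ^ 3 * v ^ 3))) 0 1.
Proof.
pose proof (RInt_comp_lin (fun w => w ^ k * exp (- w ^ 3)) l 0 0 1) as H.
replace (l * 0 + 0) with 0 in H by ring. replace (l * 1 + 0) with l in H by ring.
unfold gam. rewrite <- H by (eexists; apply is_RInt_gam).
rewrite <- (RInt_scal (V := R_CompleteNormedModule)).
- apply RInt_ext. intros v _. unfold scal; simpl. unfold mult; simpl.
  rewrite Rplus_0_r, Rpow_mult_distr, pow_add. simpl.
  replace (l * v * (l * v * (l * v * 1))) with (l * (l * (l * 1)) * (v * (v * (v * 1)))) by ring.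
  ring.
- apply ex_RInt_derivable. intros x. auto_derive. easy.
Qed.

(** Rescaling by $l=n^{1/3}$ turns $e^{-w^3}$ into $e^{-nv^3}$, close to $(1-v^3)^n$. The error
    $4/n$ is multiplied by $l^{k+1}\le l^2$, which leaves $4/l$. *)
Lemma cubic_beta_gam k n : (k <= 1)%nat -> (1 <= n)%nat ->
  gam k (cbrt (INR n)) - 4 / cbrt (INR n) <= cbrt (INR n) ^ (k + 1) * cubic_beta k n
  <= gam k (cbrt (INR n)).
Proof.
intros Hk Hn. assert (Hn' := le_INR _ _ Hn). simpl in Hn'.
pose proof (cbrt_cube (INR n) ltac:(lra)) as H3. pose proof (cbrt_pos (INR n)) as Hl.
set (l := cbrt (INR n)) in *.
assert (Hl1 : 1 <= l).
{ apply Rnot_lt_le. intros H. assert (l ^ 3 < 1) by (apply cube_bound; lra). lra. }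
set (X := RInt (fun v => v ^ k * exp (- (l ^ 3 * v ^ 3))) 0 1).
assert (IX : is_RInt (fun v => v ^ k * exp (- (l ^ 3 * v ^ 3))) 0 1 X).
{ apply (RInt_correct (fun v => v ^ k * exp (- (l ^ 3 * v ^ 3)))).
  apply ex_RInt_derivable. intros x. auto_derive. easy. }
assert (B : forall v, 0 < v < 1 -> 0 <= v ^ k <= 1 /\ 0 <= v ^ 3 <= 1).
{ intros v Hv. split; split; try (apply pow_le; lra);
    [rewrite <- (pow1 k)|rewrite <- (pow1 3)]; apply pow_incr; lra. }
assert (U : cubic_beta k n <= X).
{ apply (is_RInt_le _ _ 0 1 _ _ Rle_0_1 (is_RInt_cubic_beta k n) IX).
  intros v Hv. destruct (B v Hv) as [B1 B2]. rewrite H3.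
  apply Rmult_le_compat_l; [lra|]. now apply pow_exp_bounds. }
assert (L : X - 4 / INR n <= cubic_beta k n).
{ pose proof (is_RInt_lin _ _ _ _ 1 (-1) _ _ IX (is_RInt_const 0 1 (4 / INR n))) as I.
  replace (X - 4 / INR n) with (1 * X + -1 * scal (1 - 0) (4 / INR n))
    by (unfold scal; simpl; unfold mult; simpl; ring).
  apply (is_RInt_le _ _ 0 1 _ _ Rle_0_1 I (is_RInt_cubic_beta k n)).
  intros v Hv. destruct (B v Hv) as [B1 B2]. rewrite H3.
  pose proof (pow_exp_bounds (v ^ 3) n Hn B2) as [P _].
  assert (0 < 4 / INR n) by (apply Rdiv_lt_0_compat; lra).
  apply Rle_trans with (v ^ k * (exp (- (INR n * v ^ 3)) - 4 / INR n)); [nra|].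
  apply Rmult_le_compat_l; lra. }
rewrite gam_scale. fold X.
assert (Hlk : 0 < l ^ (k + 1) <= l ^ 2).
{ split; [now apply pow_lt|]. apply Rle_pow; [lra|lia]. }
assert (E : l ^ 2 * (4 / INR n) = 4 / l) by (rewrite <- H3; field; lra).
split.
- apply Rle_trans with (l ^ (k + 1) * (X - 4 / INR n)); [|apply Rmult_le_compat_l; lra].
  rewrite Rmult_minus_distr_l. assert (0 < 4 / INR n) by (apply Rdiv_lt_0_compat; lra).
  rewrite <- E. nra.
- apply Rmult_le_compat_l; lra.
Qed.

Lemma is_lim_seq_cbrt : is_lim_seq (fun n => cbrt (INR n)) p_infty.
Proof.
apply (filterlim_comp _ _ _ INR cbrt _ (Rbar_locally p_infty));
  [apply is_lim_seq_INR|apply filterlim_cbrt_infty].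
Qed.

Definition euler_quotient (s : R) (n : nat) : R :=
  Rpower (INR n) s * INR (fact n) / rising s (S n).

(** Gauss's product at $s=1/3$ and $s=2/3$: the quotient is three times the rescaled cubic beta
    integral, which is squeezed against the incomplete gamma integral. *)
Lemma Gamma_euler_limit k s : (k <= 1)%nat -> INR k + 1 = 3 * s ->
  0 < Gamma s /\ is_lim_seq (euler_quotient s) (Gamma s).
Proof.
intros Hk Hs. destruct (gam_lim_ex k Hk) as [g [Hg0 Hg]].
assert (EG : Gamma s = 3 * g).
{ rewrite <- (Gamma_gam k g Hg). f_equal. lra. }
rewrite EG. split; [lra|].
assert (HG : is_lim_seq (fun n => gam k (cbrt (INR n))) g).
{ apply (filterlim_comp _ _ _ (fun n => cbrt (INR n)) (gam k) _ (Rbar_locally p_infty));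
    [apply is_lim_seq_cbrt|exact Hg]. }
apply (is_lim_seq_ext (fun n => 3 * (cbrt (INR n) ^ (k + 1) * cubic_beta k n))).
- intros n. rewrite (cubic_beta_rising k n s Hs), cbrt_pow, plus_INR. simpl (INR 1).
  rewrite Hs. unfold euler_quotient. replace (3 * s / 3) with s by field.
  pose proof (rising_pos s (S n)). pose proof (pos_INR k). field. lra.
- apply (is_lim_seq_scal_l (fun n => cbrt (INR n) ^ (k + 1) * cubic_beta k n) 3 g).
  apply (is_lim_seq_le_le_loc (fun n => gam k (cbrt (INR n)) - 4 / cbrt (INR n)) _
    (fun n => gam k (cbrt (INR n)))).
  + exists 1%nat. intros n Hn. now apply cubic_beta_gam.
  + replace (Finite g) with (Finite (g - 0)) by (f_equal; ring).
    apply is_lim_seq_minus'; [exact HG|].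
    replace (Finite 0) with (Rbar_mult 4 (Rbar_inv p_infty)) by (simpl; f_equal; ring).
    apply (is_lim_seq_scal_l (fun n => / cbrt (INR n)) 4).
    apply is_lim_seq_inv; [apply is_lim_seq_cbrt|easy].
  + exact HG.
Qed.

(** * The value at 1/2 *)

Lemma rising_dup a n : rising (2 * a) (2 * n) = 4 ^ n * rising a n * rising (a + 1 / 2) n.
Proof.
induction n as [|n IH]; [simpl; ring|].
replace (2 * S n)%nat with (S (S (2 * n))) by lia.
change (rising (2 * a) (S (S (2 * n))))
  with (rising (2 * a) (2 * n) * (2 * a + INR (2 * n)) * (2 * a + INR (S (2 * n)))).
rewrite IH, S_INR, mult_INR. simpl. field.
Qed.

Lemma rising_1 n : rising 1 n = INR (fact n).
Proof.
induction n as [|n IH]; [easy|]. rewrite fact_simpl, mult_INR, S_INR. simpl. rewrite IH. ring.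
Qed.

Lemma is_lim_seq_double (u : nat -> R) (l : Rbar) :
  is_lim_seq u l -> is_lim_seq (fun n => u (2 * n)%nat) l.
Proof.
intros H. apply (is_lim_seq_subseq u l (fun n => (2 * n)%nat)); [|exact H].
apply eventually_subseq. intros n. lia.
Qed.

Lemma is_lim_seq_ratio_INR (a b c : R) : 0 < b -> 0 <= c ->
  is_lim_seq (fun n => (INR n + a) / (b * INR n + c)) (1 / b).
Proof.
intros Hb Hc.
apply (is_lim_seq_ext_loc (fun n => (1 + a / INR n) / (b + c / INR n))).
- exists 1%nat. intros n Hn. apply le_INR in Hn. simpl in Hn.
  field. split; nra.
- replace (Finite (1 / b)) with (Finite ((1 + 0) / (b + 0))) by (f_equal; field; lra).
  apply is_lim_seq_div'; [| |lra];
    apply is_lim_seq_plus'; try apply is_lim_seq_const; apply is_lim_seq_inv_INR.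
Qed.

Lemma euler_quotient_rising s n : 0 < s -> (1 <= n)%nat ->
  0 < euler_quotient s n /\
  rising s n = Rpower (INR n) s * INR (fact n) / (euler_quotient s n * (s + INR n)).
Proof.
intros Hs Hn. unfold euler_quotient. simpl rising.
assert (H1 : 0 < Rpower (INR n) s) by apply exp_pos.
pose proof (rising_pos s n Hs). pose proof (INR_fact_lt_0 n). pose proof (pos_INR n).
split.
- apply Rdiv_lt_0_compat; apply Rmult_lt_0_compat; lra.
- field. repeat split; lra.
Qed.

(** Duplication of the rising factorials of $1/3$ and $1$ rewrites the coefficient as
    $(1/3)_{2n}(1/3)_n/((2/3)_n(2n)!)$. Hence $\Gamma(1/6)$ and $\Gamma(1/2)$ do not appear, and
    $(2n)^{1/3}$ supplies the power of 2. *)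
Lemma hyp_E_equiv :
  is_lim_seq (fun n => INR n * hyp (1 / 6) (1 / 3) (1 / 2) n)
    (Rpower 2 (1 / 3) / 2 * (Gamma (2 / 3) / (Gamma (1 / 3) * Gamma (1 / 3)))).
Proof.
destruct (Gamma_euler_limit 0 (1 / 3)) as [G1 L1]; [lia|simpl; field|].
destruct (Gamma_euler_limit 1 (2 / 3)) as [G2 L2]; [lia|simpl; field|].
apply (is_lim_seq_ext_loc (fun n => Rpower 2 (1 / 3) *
  ((INR n + 2 / 3) / (1 * INR n + 1 / 3)) * ((INR n + 0) / (2 * INR n + 1 / 3)) *
  (euler_quotient (2 / 3) n / (euler_quotient (1 / 3) (2 * n) * euler_quotient (1 / 3) n)))).
- exists 1%nat. intros n Hn. assert (Hn' := le_INR _ _ Hn). simpl in Hn'.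
  destruct (euler_quotient_rising (1 / 3) n) as [P1 E1]; [lra|lia|].
  destruct (euler_quotient_rising (2 / 3) n) as [P2 E2]; [lra|lia|].
  destruct (euler_quotient_rising (1 / 3) (2 * n)) as [P3 E3]; [lra|lia|].
  pose proof (rising_dup (1 / 6) n) as D1. pose proof (rising_dup (1 / 2) n) as D2.
  replace (2 * (1 / 6)) with (1 / 3) in D1 by field.
  replace (1 / 6 + 1 / 2) with (2 / 3) in D1 by field.
  replace (2 * (1 / 2)) with 1 in D2 by field.
  replace (1 / 2 + 1 / 2) with 1 in D2 by field.
  rewrite !rising_1 in D2.
  assert (H4 : 0 < 4 ^ n) by (apply pow_lt; lra).
  pose proof (rising_pos (2 / 3) n ltac:(lra)) as R2.
  pose proof (rising_pos (1 / 2) n ltac:(lra)) as R3.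
  pose proof (INR_fact_lt_0 n) as F1. pose proof (INR_fact_lt_0 (2 * n)) as F2.
  assert (E : hyp (1 / 6) (1 / 3) (1 / 2) n =
    rising (1 / 3) (2 * n) * rising (1 / 3) n / (rising (2 / 3) n * INR (fact (2 * n)))).
  { unfold hyp. rewrite D1, D2. field. repeat split; lra. }
  rewrite E, E1, E2, E3. rewrite mult_INR. simpl (INR 2).
  replace (Rpower ((1 + 1) * INR n) (1 / 3)) with (Rpower 2 (1 / 3) * Rpower (INR n) (1 / 3))
    by (apply Rpower_mult_distr; lra).
  replace (Rpower (INR n) (2 / 3)) with (Rpower (INR n) (1 / 3) * Rpower (INR n) (1 / 3))
    by (rewrite <- Rpower_plus; f_equal; field).
  assert (0 < Rpower (INR n) (1 / 3)) by apply exp_pos.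
  field. repeat split; lra.
- replace (Finite (Rpower 2 (1 / 3) / 2 * (Gamma (2 / 3) / (Gamma (1 / 3) * Gamma (1 / 3)))))
    with (Finite (Rpower 2 (1 / 3) * (1 / 1) * (1 / 2) *
      (Gamma (2 / 3) / (Gamma (1 / 3) * Gamma (1 / 3))))) by (f_equal; field; lra).
  apply is_lim_seq_mult'; [apply is_lim_seq_mult'; [apply is_lim_seq_mult'|]|].
  + apply is_lim_seq_const.
  + apply is_lim_seq_ratio_INR; lra.
  + apply is_lim_seq_ratio_INR; lra.
  + apply is_lim_seq_div'; [exact L2| |nra].
    apply is_lim_seq_mult'; [now apply (is_lim_seq_double (euler_quotient (1 / 3)))|exact L1].
Qed.

Lemma is_lim_seq_bounded_div (r t : nat -> R) (C : R) :
  (forall n, Rabs (r n) <= C) -> is_lim_seq t p_infty -> is_lim_seq (fun n => r n / t n) 0.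
Proof.
intros Hr Ht. apply is_lim_seq_abs_0.
apply (is_lim_seq_le_le (fun _ => 0) _ (fun n => C * Rabs (/ t n))).
- intros n. split; [apply Rabs_pos|]. unfold Rdiv. rewrite Rabs_mult.
  apply Rmult_le_compat_r; [apply Rabs_pos|apply Hr].
- apply is_lim_seq_const.
- replace (Finite 0) with (Rbar_mult C 0) by (simpl; f_equal; ring).
  apply is_lim_seq_scal_l. apply (proj1 (is_lim_seq_abs_0 (fun n => / t n))).
  apply (is_lim_seq_inv t p_infty); [exact Ht|easy].
Qed.

Lemma ex_pseries_hyp a b c x : hyp_ok a b c -> 0 <= x < 1 -> ex_pseries (hyp a b c) x.
Proof.
intros Hok Hx. apply CV_radius_inside, hyp_radius; [easy|]. apply Rabs_lt_1_intro. lra.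
Qed.

Lemma cubF_log_equiv (z : nat -> R) : (forall n, 0 < z n <= 1) ->
  is_lim_seq (fun n => - ln (z n)) p_infty ->
  is_lim_seq (fun n => cubF (1 - z n) / - ln (z n)) (sqrt 3 / (2 * PI)).
Proof.
intros Hz Hinf.
pose proof (pseries_log_equiv _ _ (fun n => 1 - z n)
  (fun x => ex_pseries_hyp _ _ _ x hyp_ok_F) hyp_F_equiv) as H.
assert (E : forall n, 1 - (1 - z n) = z n) by (intros; ring).
eapply is_lim_seq_ext; [|apply H].
- intros n. cbv beta. now rewrite E.
- intros n. specialize (Hz n). lra.
- eapply is_lim_seq_ext; [|exact Hinf]. intros n. cbv beta. now rewrite E.
Qed.

Lemma is_lim_seq_INR_plus (a : R) : is_lim_seq (fun n => INR n + a) p_infty.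
Proof.
apply (is_lim_seq_plus INR (fun _ => a) p_infty a);
  [apply is_lim_seq_INR|apply is_lim_seq_const|easy].
Qed.

(* Compare the logarithmic singularities at [0] of both sides of [cubF_even_part]. *)
Lemma cubF_half : cubF (1 / 2) = sqrt 3 / (2 * PI) * (1 / Rpower 2 (1 / 3)) * Beta (1 / 3) (1 / 3).
Proof.
destruct (Gamma_euler_limit 0 (1 / 3)) as [G1 _]; [lia|simpl; field|].
destruct (Gamma_euler_limit 1 (2 / 3)) as [G2 _]; [lia|simpl; field|].
(* A sequence tending to 0 with explicit logarithms; the shift by 2 keeps it below $1/2$ from the
   start. *)
set (z := fun n => exp (- (INR n + 2))).
assert (Hz : forall n, 0 < z n < 1 / 2).
{ intros n. split; [apply exp_pos|]. pose proof (pos_INR n).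
  unfold z. rewrite exp_Ropp. pose proof (exp_ineq1 (INR n + 2) ltac:(lra)).
  replace (1 / 2) with (/ 2) by field. apply Rinv_lt_contravar; lra. }
assert (Hln : forall n, - ln (z n) = INR n + 2) by (intros n; unfold z; rewrite ln_exp; ring).
set (t := fun n => INR n + 2) in *.
assert (Ht : is_lim_seq t p_infty) by apply is_lim_seq_INR_plus.
assert (Ht0 : forall n, 0 < t n) by (intros n; unfold t; pose proof (pos_INR n); lra).
set (r := fun n => ln 4 + ln (1 - z n)).
set (u := fun n => (1 - 2 * z n) ^ 2).
(* Since $1-(1-2z)^2 = 4z(1-z)$, the two logarithmic scales differ by the bounded quantity $r$. *)
assert (Hu : forall n, - ln (1 - u n) = t n - r n).
{ intros n. destruct (Hz n). unfold u.
  replace (1 - (1 - 2 * z n) ^ 2) with (z n * (4 * (1 - z n))) by ring.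
  rewrite !ln_mult by lra. specialize (Hln n). unfold r. fold (t n) in Hln. lra. }
assert (Hr : is_lim_seq (fun n => r n / t n) 0).
{ apply (is_lim_seq_bounded_div _ _ (ln 4)); [|exact Ht]. intros n. destruct (Hz n).
  assert (ln (1 - z n) <= 0) by (rewrite <- ln_1; left; apply ln_increasing; lra).
  assert (- ln 4 <= ln (1 - z n)).
  { rewrite <- ln_Rinv by lra. left. apply ln_increasing; lra. }
  assert (0 < ln 4) by (rewrite <- ln_1; apply ln_increasing; lra).
  unfold r. apply Rabs_le. lra. }
assert (Hsmall : is_lim_seq (fun n => cubF (z n) / t n) 0).
{ apply (is_lim_seq_bounded_div _ _ (cubF (1 / 2))); [|exact Ht]. intros n. destruct (Hz n).
  pose proof (cubF_ge_1 (z n) ltac:(lra)).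
  pose proof (hypF_incr _ _ _ (z n) (1 / 2) hyp_ok_F ltac:(lra) ltac:(lra) ltac:(lra)) as Hi.
  fold cubF in Hi. rewrite Rabs_pos_eq; lra. }
assert (HL : is_lim_seq (fun n => cubF (1 - z n) / t n) (sqrt 3 / (2 * PI))).
{ eapply is_lim_seq_ext; [|apply (cubF_log_equiv z)].
  - intros n. cbv beta. now rewrite Hln.
  - intros n. specialize (Hz n). lra.
  - eapply is_lim_seq_ext; [|exact Ht]. intros n. symmetry. apply Hln. }
assert (Htr : is_lim_seq (fun n => (t n - r n) / t n) 1).
{ replace (Finite 1) with (Finite (1 - 0)) by (f_equal; ring).
  apply (is_lim_seq_ext (fun n => 1 - r n / t n)).
  - intros n. specialize (Ht0 n). field. lra.
  - apply is_lim_seq_minus'; [apply is_lim_seq_const|exact Hr]. }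
assert (Hinf : is_lim_seq (fun n => - ln (1 - u n)) p_infty).
{ apply (is_lim_seq_ext (fun n => (t n - r n) / t n * t n)).
  - intros n. rewrite Hu. specialize (Ht0 n). field. lra.
  - apply (is_lim_seq_mult _ _ 1 p_infty); [exact Htr|exact Ht|].
    unfold is_Rbar_mult; simpl. destruct (Rle_dec 0 1) as [H|H]; [|lra].
    destruct (Rle_lt_or_eq_dec 0 1 H); [easy|lra]. }
pose proof (pseries_log_equiv _ _ u (fun x => ex_pseries_hyp _ _ _ x hyp_ok_E) hyp_E_equiv) as HM.
assert (Hu01 : forall n, 0 <= u n < 1).
{ intros n. destruct (Hz n). unfold u. split; [apply pow2_ge_0|]. simpl. nra. }
specialize (HM Hu01 Hinf).
set (M := Rpower 2 (1 / 3) / 2 * (Gamma (2 / 3) / (Gamma (1 / 3) * Gamma (1 / 3)))) in *.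
(* Both sides of the even-part identity are divided by $t$. On the right $M =
   2^{1/3}/(2B(1/3,1/3))$, so the equation can be solved for $F(1/2)$. *)
assert (E : Finite (0 + sqrt 3 / (2 * PI)) = Finite (2 * cubF (1 / 2) * (M * 1))).
{ rewrite <- (is_lim_seq_unique (fun n => cubF (z n) / t n + cubF (1 - z n) / t n) _
    (is_lim_seq_plus' _ _ _ _ Hsmall HL)).
  apply is_lim_seq_unique.
  apply (is_lim_seq_ext_loc (fun n => 2 * cubF (1 / 2) *
    (PSeries (hyp (1 / 6) (1 / 3) (1 / 2)) (u n) / - ln (1 - u n) * ((t n - r n) / t n)))).
  - apply is_lim_seq_spec in Hinf. destruct (Hinf 0) as [N HN]. exists N. intros n Hn.
    specialize (HN n Hn). specialize (Ht0 n). pose proof (cubF_even_part (z n) (Hz n)) as Ev.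
    replace (cubF (z n) / t n + cubF (1 - z n) / t n)
      with ((cubF (z n) + cubF (1 - z n)) / t n) by (field; lra).
    rewrite Ev, Hu. rewrite Hu in HN.
    change (quadE ((1 - 2 * z n) ^ 2)) with (PSeries (hyp (1 / 6) (1 / 3) (1 / 2)) (u n)).
    field. lra.
  - apply (is_lim_seq_scal_l _ (2 * cubF (1 / 2)) (M * 1)).
    apply is_lim_seq_mult'; assumption. }
injection E as E.
assert (HP : 0 < Rpower 2 (1 / 3)) by apply exp_pos.
unfold Beta. replace (1 / 3 + 1 / 3) with (2 / 3) by field.
assert (HM0 : 0 < M).
{ unfold M. apply Rmult_lt_0_compat; apply Rdiv_lt_0_compat; try lra.
  now apply Rmult_lt_0_compat. }
apply (Rmult_eq_reg_r (2 * M)); [|lra].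
transitivity (sqrt 3 / (2 * PI)); [lra|].
unfold M. pose proof PI_RGT_0. field. lra.
Qed.

(** * The modular parametrisation *)

(** This and [gauss2] are the terms of $\theta_3$ and $\theta_2$ at $iy$ with $a=\pi y$. *)
Definition gauss3 (a : R) (n : Z) : R := exp (- a * IZR (n ^ 2)).
Definition gauss2 (a : R) (n : Z) : R := exp (- a * (IZR ((2 * n + 1) ^ 2) / 4)).

Lemma gauss3_summable a : 0 < a -> exists s, is_usum (gauss3 a) s.
Proof.
intros Ha.
assert (Hle : forall n, gauss3 a n <= exp (- a * IZR (Z.abs n))).
{ intros n. apply exp_le_compat.
  assert (H : (Z.abs n <= n ^ 2)%Z) by nia. apply IZR_le in H. nra. }
destruct (is_usum_dominated _ _ _ Hle (is_usum_exp_Zabs a Ha)) as [s [Hs _]]. now exists s.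
Qed.

Lemma gauss2_summable a : 0 < a -> exists s, is_usum (gauss2 a) s.
Proof.
intros Ha.
assert (Hle : forall n, gauss2 a n <= exp a * exp (- a * IZR (Z.abs n))).
{ intros n. unfold gauss2. rewrite <- exp_plus. apply exp_le_compat.
  assert (H : (4 * Z.abs n <= (2 * n + 1) ^ 2 + 4)%Z) by nia.
  apply IZR_le in H. rewrite mult_IZR, plus_IZR in H. nra. }
destruct (is_usum_dominated _ _ _ Hle
  (is_usum_scal _ (exp a) _ (exp_pos a) (is_usum_exp_Zabs a Ha))) as [s [Hs _]].
now exists s.
Qed.

(* The rows with even second coordinate [2 k] give [j^2 + 3 k^2], those with odd second
   coordinate [2 k + 1] give [(j + 1/2)^2 + 3 (k + 1/2)^2]. *)
Lemma eis_theta_jacobi s : 0 < s ->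
  eis_theta s = usum (gauss2 s) * usum (gauss2 (3 * s)) + usum (gauss3 s) * usum (gauss3 (3 * s)).
Proof.
intros Hs. unfold eis_theta. apply usum_unique.
destruct (gauss2_summable s Hs) as [a2 A2]. destruct (gauss2_summable (3 * s)) as [b2 B2]; [lra|].
destruct (gauss3_summable s Hs) as [a3 A3]. destruct (gauss3_summable (3 * s)) as [b3 B3]; [lra|].
rewrite (usum_unique _ _ A2), (usum_unique _ _ B2), (usum_unique _ _ A3), (usum_unique _ _ B3).
set (g := fun p : bool * (Z * Z) => let '(b, (j, k)) := p in
  if b then (j + k + 1, 2 * k + 1)%Z else (j + k, 2 * k)%Z).
apply (is_usum_bij g).
- intros [[] [j k]] [[] [j' k']]; unfold g; intros [H1 H2]%pair_equal_spec;
    try (exfalso; lia); repeat f_equal; lia.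
- intros [x y]. pose proof (Z.div_mod y 2 ltac:(lia)). pose proof (Z.mod_pos_bound y 2 ltac:(lia)).
  destruct (Z.eq_dec (y mod 2) 0).
  + exists (false, (x - y / 2, y / 2)%Z). unfold g. f_equal; lia.
  + exists (true, (x - y / 2 - 1, y / 2)%Z). unfold g. f_equal; lia.
- replace (a2 * b2 + a3 * b3)
    with (lsum (fun b : bool => if b then a2 * b2 else a3 * b3) [true; false]) by (simpl; ring).
  apply is_usum_fin.
  + repeat constructor; simpl; intuition congruence.
  + intros []; simpl; auto.
  + intros []; unfold g.
    * eapply is_usum_ext; [|apply (is_usum_prod (gauss2 s) (gauss2 (3 * s)) _ _
        (fun x => Rlt_le _ _ (exp_pos _)) (fun x => Rlt_le _ _ (exp_pos _)) A2 B2)].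
      intros [j k]. unfold gauss2, gauss, eis_norm; cbn [fst snd]. rewrite <- exp_plus. f_equal.
      rewrite !Z.pow_2_r.
      repeat (rewrite plus_IZR || rewrite minus_IZR || rewrite mult_IZR). field.
    * eapply is_usum_ext; [|apply (is_usum_prod (gauss3 s) (gauss3 (3 * s)) _ _
        (fun x => Rlt_le _ _ (exp_pos _)) (fun x => Rlt_le _ _ (exp_pos _)) A3 B3)].
      intros [j k]. unfold gauss3, gauss, eis_norm; cbn [fst snd]. rewrite <- exp_plus. f_equal.
      rewrite !Z.pow_2_r.
      repeat (rewrite plus_IZR || rewrite minus_IZR || rewrite mult_IZR). field.
Qed.

Lemma ZSeries_usum (f : Z -> C) (g : Z -> R) s :
  (forall n, f n = RtoC (g n)) -> (forall n, 0 <= g n) -> is_usum g s -> ZSeries f = RtoC s.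
Proof.
intros Hfg Hg Hs.
destruct (is_usum_inj Z.of_nat g s) as [t1 [T1 _]]; [intros; lia|easy|].
destruct (is_usum_inj (fun n => - Z.of_nat (S n))%Z g s) as [t2 [T2 _]]; [intros; lia|easy|].
rewrite <- (is_usum_unique _ _ _ (is_usum_Z g t1 t2 T1 T2) Hs).
assert (H0 : Series (fun _ => 0) = 0) by apply is_series_unique, is_series_zero.
unfold ZSeries, CSeries.
assert (E : forall h : nat -> Z, Series (fun n => Im (f (h n))) = 0).
{ intros h. rewrite <- H0. apply Series_ext. intros n. now rewrite Hfg. }
assert (E' : forall h : nat -> Z, Series (fun n => Re (f (h n))) = Series (fun n => g (h n))).
{ intros h. apply Series_ext. intros n. now rewrite Hfg. }
rewrite (E Z.of_nat), (E (fun n => - Z.of_nat (S n))%Z).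
rewrite (E' Z.of_nat), (E' (fun n => - Z.of_nat (S n))%Z).
rewrite (is_usum_Series _ _ (fun n => Hg _) T1), (is_usum_Series _ _ (fun n => Hg _) T2).
unfold Cplus, RtoC; simpl. f_equal. ring.
Qed.

Lemma qpow_imaginary r y : qpow r (0, y) = RtoC (exp (- (2 * PI * r * y))).
Proof.
unfold qpow, cexp, Cmult, RtoC, Ci; simpl.
replace ((2 * PI * r * 0 - 0 * 1) * y + (2 * PI * r * 1 + 0 * 0) * 0) with 0 by ring.
rewrite cos_0, sin_0. f_equal; [rewrite Rmult_1_r; f_equal; ring|ring].
Qed.

Lemma theta2_imaginary y : 0 < y -> theta2 (0, y) = RtoC (usum (gauss2 (PI * y))).
Proof.
intros Hy. assert (Ha : 0 < PI * y) by (apply Rmult_lt_0_compat; [apply PI_RGT_0|easy]).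
destruct (gauss2_summable _ Ha) as [s Hs]. rewrite (usum_unique _ _ Hs).
apply (ZSeries_usum _ (gauss2 (PI * y))); [|intros; left; apply exp_pos|easy].
intros n. rewrite qpow_imaginary. unfold gauss2. do 2 f_equal. field.
Qed.

Lemma theta3_imaginary y : 0 < y -> theta3 (0, y) = RtoC (usum (gauss3 (PI * y))).
Proof.
intros Hy. assert (Ha : 0 < PI * y) by (apply Rmult_lt_0_compat; [apply PI_RGT_0|easy]).
destruct (gauss3_summable _ Ha) as [s Hs]. rewrite (usum_unique _ _ Hs).
apply (ZSeries_usum _ (gauss3 (PI * y))); [|intros; left; apply exp_pos|easy].
intros n. rewrite qpow_imaginary. unfold gauss3. do 2 f_equal. field.
Qed.

Lemma phi_imaginary y : 0 < y -> phi (0, y) = RtoC (eis_theta (2 * PI * y)).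
Proof.
intros Hy. unfold phi.
assert (E : forall k, Cmult (RtoC k) (0, y) = (0, k * y)).
{ intros k. unfold Cmult, RtoC; simpl. f_equal; ring. }
rewrite !E, !theta2_imaginary, !theta3_imaginary by lra.
rewrite eis_theta_jacobi by (pose proof PI_RGT_0; apply Rmult_lt_0_compat; lra).
replace (PI * (2 * y)) with (2 * PI * y) by ring.
replace (PI * (6 * y)) with (3 * (2 * PI * y)) by ring.
now rewrite RtoC_plus, !RtoC_mult.
Qed.

(** * The cubic modulus under s -> 3s *)

Definition cubic_modulus (s : R) : R := (eis_coset_theta (s / 3) / eis_theta s) ^ 3.

Lemma eis_coset_theta_pos s : 0 < s -> 0 < eis_coset_theta s.
Proof.
intros Hs. apply Rlt_le_trans with (exp (- s)); [apply exp_pos|].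
now apply eis_coset_theta_ge.
Qed.

Lemma eis_theta_lt_3 s : 69 / 20 <= s -> eis_theta s < 3.
Proof.
intros Hs. apply Rle_lt_trans with (1 := eis_theta_le s ltac:(lra)).
(* From $e^{s/6} \ge 1+s/6 \ge 63/40$ follows $e^{s/2} \ge (63/40)^3 > 39/10$. Then the majorant in
   one coordinate is at most $49/29$, whose square is below 3. *)
assert (Hr : 0 < exp (- (s / 2)) <= 10 / 39).
{ split; [apply exp_pos|]. rewrite exp_Ropp.
  replace (10 / 39) with (/ (39 / 10)) by field. apply Rinv_le_contravar; [lra|].
  replace (s / 2) with (INR 3 * (s / 6)) by (simpl; field). rewrite <- exp_pow.
  apply Rle_trans with ((63 / 40) ^ 3); [lra|].
  apply pow_incr. split; [lra|]. pose proof (exp_ineq1 (s / 6) ltac:(lra)). lra. }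
unfold sq_bound. set (r := exp (- (s / 2))) in *.
assert (K : 0 < (1 + r) / (1 - r) <= 49 / 29).
{ split; [apply Rdiv_lt_0_compat; lra|]. apply (Rmult_le_reg_r (1 - r)); [lra|].
  unfold Rdiv at 1. rewrite Rmult_assoc, Rinv_l by lra. lra. }
nra.
Qed.

(** This is positivity of the Borwein function $b(s)$. By the splitting, the coset series is half of
    $a(s)-a(3s)$, hence less than $(3-1)/2 = 1 \le a(3s)$. *)
Lemma eis_coset_lt_theta s : 69 / 20 <= s -> eis_coset_theta s < eis_theta (3 * s).
Proof.
intros Hs. pose proof (eis_theta_split s ltac:(lra)). pose proof (eis_theta_lt_3 s Hs).
pose proof (eis_theta_ge_1 (3 * s) ltac:(lra)). lra.
Qed.

(* With [x = b / a] in the Borwein notation [a = eis_theta s], [c = eis_coset_theta (s / 3)],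
   the map [s -> 3 s] sends [x^3] to [1 - cubic_moebius x ^ 3]. *)
Lemma cubic_modulus_step s : 69 / 20 <= s ->
  exists x, 0 < x < 1 /\ 1 + 2 * x = 3 * eis_theta (3 * s) / eis_theta s /\
    cubic_modulus s = 1 - x ^ 3 /\ cubic_modulus (3 * s) = cubic_moebius x ^ 3.
Proof.
intros Hs. unfold cubic_modulus, cubic_moebius.
pose proof (eis_theta_split s ltac:(lra)) as Hsp.
pose proof (eis_coset_cube (s / 3) ltac:(lra)) as Hc.
replace (3 * (s / 3)) with s in Hc by field. replace (9 * (s / 3)) with (3 * s) in Hc by field.
replace (3 * s / 3) with s by field.
pose proof (eis_coset_lt_theta s Hs) as Hlt. pose proof (eis_coset_theta_pos s ltac:(lra)) as Hp.
set (A := eis_theta s) in *. set (A' := eis_theta (3 * s)) in *. set (C' := eis_coset_theta s) in *.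
set (C := eis_coset_theta (s / 3)) in *.
exists ((A' - C') / A). split; [|split; [|split]].
- split; [apply Rdiv_lt_0_compat; lra|].
  apply (Rmult_lt_reg_r A); [lra|]. unfold Rdiv. rewrite Rmult_assoc, Rinv_l by lra. lra.
- rewrite Hsp. field. lra.
- replace ((C / A) ^ 3) with (C ^ 3 / A ^ 3) by (field; lra).
  rewrite Hc, Hsp. field. lra.
- rewrite Hsp. f_equal. field. split; lra.
Qed.

Lemma cubic_modulus_bound s : 69 / 20 <= s -> 0 < cubic_modulus s < 1.
Proof.
intros Hs. destruct (cubic_modulus_step s Hs) as [x [Hx [_ [-> _]]]].
assert (0 < x ^ 3) by (apply pow_lt; lra).
pose proof (cube_bound x ltac:(lra)). lra.
Qed.

(** The first relation is [cubF_transform] at $x$. The second is the same transformation at the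
    image $y$ of $x$, using the involution and $(1+2x)(1+2y)=3$; the factor 3 arises because
    $3/(1+2y) = 1+2x = 3a(3s)/a(s)$. *)
Lemma cubF_modulus_step s : 69 / 20 <= s ->
  cubF (cubic_modulus (3 * s)) / eis_theta (3 * s) = cubF (cubic_modulus s) / eis_theta s /\
  cubF (1 - cubic_modulus (3 * s)) / eis_theta (3 * s)
    = 3 * (cubF (1 - cubic_modulus s) / eis_theta s).
Proof.
intros Hs. destruct (cubic_modulus_step s Hs) as [x [Hx [E [-> ->]]]].
pose proof (eis_theta_ge_1 s ltac:(lra)). pose proof (eis_theta_ge_1 (3 * s) ltac:(lra)).
split.
- rewrite (cubF_transform x Hx), E. field. lra.
- set (y := cubic_moebius x).
  assert (Hy : 0 < y < 1).
  { split; [apply Rdiv_lt_0_compat; lra|]. apply (cubic_moebius_bound x). lra. }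
  assert (Ex : cubic_moebius y = x) by (unfold y, cubic_moebius; field; lra).
  assert (Ek : 3 / (1 + 2 * y) = 1 + 2 * x) by (unfold y, cubic_moebius; field; lra).
  rewrite (cubF_transform y Hy), Ek, Ex, E.
  replace (1 - (1 - x ^ 3)) with (x ^ 3) by ring. field. lra.
Qed.

Lemma cubF_modulus_iter s n : 69 / 20 <= s ->
  cubF (cubic_modulus (3 ^ n * s)) / eis_theta (3 ^ n * s) = cubF (cubic_modulus s) / eis_theta s /\
  cubF (1 - cubic_modulus (3 ^ n * s)) / eis_theta (3 ^ n * s)
    = 3 ^ n * (cubF (1 - cubic_modulus s) / eis_theta s).
Proof.
intros Hs. induction n as [|n [IH1 IH2]]; [now rewrite pow_O, !Rmult_1_l|].
assert (H1 : 1 <= 3 ^ n) by (apply pow_R1_Rle; lra).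
destruct (cubF_modulus_step (3 ^ n * s)) as [S1 S2]; [nra|].
simpl pow. rewrite Rmult_assoc, S1, S2, IH1, IH2. split; ring.
Qed.

Lemma is_lim_seq_pow3 s : 0 < s -> is_lim_seq (fun n => 3 ^ S n * s) p_infty.
Proof.
intros Hs. apply (is_lim_seq_mult (fun n => 3 ^ S n) (fun _ => s) p_infty s).
- apply -> is_lim_seq_incr_1. apply is_lim_seq_geom_p. lra.
- apply is_lim_seq_const.
- unfold is_Rbar_mult; simpl. destruct (Rle_dec 0 s) as [H|H]; [|lra].
  destruct (Rle_lt_or_eq_dec 0 s H); [easy|lra].
Qed.

Lemma is_lim_seq_exp_neg (t : nat -> R) :
  is_lim_seq t p_infty -> is_lim_seq (fun n => exp (- t n)) 0.
Proof.
intros Ht. apply (filterlim_comp _ _ _ (fun n => - t n) exp _ (Rbar_locally m_infty)).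
- apply (is_lim_seq_opp t p_infty). exact Ht.
- exact is_lim_exp_m.
Qed.

Lemma eis_theta_lim (t : nat -> R) :
  (forall n, 0 < t n) -> is_lim_seq t p_infty -> is_lim_seq (fun n => eis_theta (t n)) 1.
Proof.
intros Hp Ht.
assert (He : is_lim_seq (fun n => exp (- (t n / 2))) 0).
{ apply is_lim_seq_exp_neg. apply (is_lim_seq_mult t (fun _ => / 2) p_infty (/ 2)).
  - exact Ht.
  - apply is_lim_seq_const.
  - unfold is_Rbar_mult; simpl. destruct (Rle_dec 0 (/ 2)) as [H|H]; [|lra].
    destruct (Rle_lt_or_eq_dec 0 (/ 2) H); [easy|lra]. }
assert (Hk : is_lim_seq (fun n => sq_bound (t n / 2)) 1).
{ replace (Finite 1) with (Finite ((1 + 0) / (1 - 0))) by (f_equal; field).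
  apply is_lim_seq_div'; [apply is_lim_seq_plus'|apply is_lim_seq_minus'|lra];
    try apply is_lim_seq_const; exact He. }
apply (is_lim_seq_le_le (fun _ => 1) _ (fun n => sq_bound (t n / 2) * sq_bound (t n / 2))).
- intros n. split; [now apply eis_theta_ge_1|now apply eis_theta_le].
- apply is_lim_seq_const.
- replace (Finite 1) with (Finite (1 * 1)) by (f_equal; ring).
  now apply is_lim_seq_mult'.
Qed.

Lemma ln_le_mono x y : 0 < x -> x <= y -> ln x <= ln y.
Proof. intros Hx [H| ->]; [left; now apply ln_increasing|lra]. Qed.

(** With $u = 3^ns$, the coset series at $u$ lies between $e^{-u}$ and a constant times $e^{-u}$,
    and the denominator between 1 and 3. The index [S n] is chosen because the modulus at $3u$
    evaluates the coset series at $u \ge s$. *)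
Lemma cubic_modulus_log s : 69 / 20 <= s ->
  exists K, forall n, Rabs (3 ^ S n * s - - ln (cubic_modulus (3 ^ S n * s))) <= K.
Proof.
intros Hs. pose proof (eis_coset_theta_pos s ltac:(lra)) as Hc.
exists (3 * ln 3 + 3 * Rabs (s + ln (eis_coset_theta s))). intros n.
assert (H1 : 1 <= 3 ^ n) by (apply pow_R1_Rle; lra).
simpl pow. set (u := 3 ^ n * s). assert (Hu : s <= u) by (unfold u; nra).
replace (3 * 3 ^ n * s) with (3 * u) by (unfold u; ring).
unfold cubic_modulus. replace (3 * u / 3) with u by field.
pose proof (eis_coset_theta_pos u ltac:(lra)) as Hcu.
pose proof (eis_theta_ge_1 (3 * u) ltac:(lra)) as Ha.
pose proof (eis_theta_lt_3 (3 * u) ltac:(lra)) as Ha3.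
pose proof (eis_coset_theta_ge u ltac:(lra)) as L1. apply ln_le_mono in L1; [|apply exp_pos].
rewrite ln_exp in L1.
pose proof (eis_coset_theta_le s u ltac:(lra) Hu) as L2. apply ln_le_mono in L2; [|easy].
rewrite ln_mult, ln_exp in L2 by (easy || apply exp_pos).
assert (L3 : 0 <= ln (eis_theta (3 * u))) by (rewrite <- ln_1; apply ln_le_mono; lra).
assert (L4 : ln (eis_theta (3 * u)) <= ln 3) by (apply ln_le_mono; lra).
rewrite <- Rpower_pow by (apply Rdiv_lt_0_compat; lra).
unfold Rpower. rewrite ln_exp, ln_div by lra. simpl (INR 3).
pose proof (Rle_abs (s + ln (eis_coset_theta s))).
pose proof (Rabs_pos (s + ln (eis_coset_theta s))).
apply Rabs_le. lra.
Qed.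

(** * The value at the fixed point *)

Definition s0 : R := 2 * PI / sqrt 3.

(** The bound $\pi>3$ already gives $2\pi/\sqrt3 > 2\sqrt3$, and $69/20$ is a rational just below
    $2\sqrt3$. *)
Lemma s0_ge : 69 / 20 <= s0.
Proof.
unfold s0. assert (H3 : 0 < sqrt 3) by (apply sqrt_lt_R0; lra).
assert (Hq : sqrt 3 <= 120 / 69).
{ rewrite <- (sqrt_pow2 (120 / 69)) by lra. apply sqrt_le_1; lra. }
pose proof PI2_3_2. apply (Rmult_le_reg_r (sqrt 3)); [easy|].
unfold Rdiv at 2. rewrite Rmult_assoc, Rinv_l by lra. nra.
Qed.

Lemma pow3_ge s n : 69 / 20 <= s -> 69 / 20 <= 3 ^ n * s.
Proof. intros Hs. assert (1 <= 3 ^ n) by (apply pow_R1_Rle; lra). nra. Qed.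

Lemma cubic_modulus_log_lim s : 69 / 20 <= s ->
  is_lim_seq (fun n => - ln (cubic_modulus (3 ^ S n * s))) p_infty /\
  is_lim_seq (fun n => - ln (cubic_modulus (3 ^ S n * s)) / (3 ^ S n * s)) 1.
Proof.
intros Hs. destruct (cubic_modulus_log s Hs) as [K HK].
pose proof (is_lim_seq_pow3 s ltac:(lra)) as Ht. split.
- apply (is_lim_seq_le_p_loc (fun n => 3 ^ S n * s - K)).
  + exists 0%nat. intros n _. specialize (HK n). apply Rabs_le_between in HK. lra.
  + apply (is_lim_seq_minus (fun n => 3 ^ S n * s) (fun _ => K) p_infty K);
      [exact Ht|apply is_lim_seq_const|easy].
- pose proof (is_lim_seq_bounded_div _ _ K HK Ht) as H0.
  apply (is_lim_seq_ext (fun n => 1 -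
    (3 ^ S n * s - - ln (cubic_modulus (3 ^ S n * s))) / (3 ^ S n * s))).
  + intros n. pose proof (pow3_ge s (S n) Hs). field. split; [lra|]. apply pow_nonzero. lra.
  + replace (Finite 1) with (Finite (1 - 0)) by (f_equal; ring).
    apply is_lim_seq_minus'; [apply is_lim_seq_const|exact H0].
Qed.

Lemma eis_theta_hypergeometric s : 69 / 20 <= s -> eis_theta s = cubF (cubic_modulus s).
Proof.
intros Hs. pose proof (eis_theta_ge_1 s ltac:(lra)) as Ha.
assert (Hz : is_lim_seq (fun n => cubic_modulus (3 ^ S n * s)) 0).
{ apply (is_lim_seq_ext (fun n => exp (- - ln (cubic_modulus (3 ^ S n * s))))).
  - intros n. rewrite Ropp_involutive. apply exp_ln.
    apply cubic_modulus_bound. now apply pow3_ge.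
  - apply is_lim_seq_exp_neg. now apply cubic_modulus_log_lim. }
assert (HF : is_lim_seq (fun n => cubF (cubic_modulus (3 ^ S n * s))) 1).
{ replace (Finite 1) with (Finite (cubF 0)) by (unfold cubF; now rewrite hypF_0).
  apply (filterlim_comp _ _ _ (fun n => cubic_modulus (3 ^ S n * s)) cubF _ (locally 0));
    [exact Hz|].
  apply continuous_hypF; [apply hyp_ok_F|]. rewrite Rabs_R0. lra. }
assert (HA : is_lim_seq (fun n => eis_theta (3 ^ S n * s)) 1).
{ apply eis_theta_lim; [|apply is_lim_seq_pow3; lra].
  intros n. pose proof (pow3_ge s (S n) Hs). lra. }
assert (H1 : is_lim_seq (fun _ => cubF (cubic_modulus s) / eis_theta s) (1 / 1)).
{ apply (is_lim_seq_ext (fun n =>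
    cubF (cubic_modulus (3 ^ S n * s)) / eis_theta (3 ^ S n * s))).
  - intros n. now apply cubF_modulus_iter.
  - apply is_lim_seq_div'; [exact HF|exact HA|lra]. }
apply is_lim_seq_unique in H1. rewrite Lim_seq_const in H1. injection H1 as H1.
apply (Rmult_eq_reg_r (/ eis_theta s)); [|apply Rinv_neq_0_compat; lra].
rewrite Rinv_r by lra. unfold Rdiv in H1. lra.
Qed.

Lemma cubF_modulus_compl s : 69 / 20 <= s ->
  cubF (1 - cubic_modulus s) = sqrt 3 / (2 * PI) * s * eis_theta s.
Proof.
intros Hs. pose proof (eis_theta_ge_1 s ltac:(lra)) as Ha.
destruct (cubic_modulus_log_lim s Hs) as [L1 L2].
assert (HL := cubF_log_equiv (fun n => cubic_modulus (3 ^ S n * s))).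
cbv beta in HL.
assert (Hz : forall n, 0 < cubic_modulus (3 ^ S n * s) < 1).
{ intros n. apply cubic_modulus_bound. now apply pow3_ge. }
specialize (HL ltac:(intros n; specialize (Hz n); lra) L1).
assert (HA : is_lim_seq (fun n => eis_theta (3 ^ S n * s)) 1).
{ apply eis_theta_lim; [|apply is_lim_seq_pow3; lra].
  intros n. pose proof (pow3_ge s (S n) Hs). lra. }
set (b := cubF (1 - cubic_modulus s) / eis_theta s).
(* The limit of one sequence is computed twice: through the logarithmic asymptotics of $F(1-z)$ and
   of $z$, and through $a \to 1$. Equating the two determines $b/s$. *)
assert (H : is_lim_seq (fun n => b / s * eis_theta (3 ^ S n * s)) (sqrt 3 / (2 * PI) * 1)).
{ apply (is_lim_seq_ext (fun n =>
    cubF (1 - cubic_modulus (3 ^ S n * s)) / - ln (cubic_modulus (3 ^ S n * s))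
    * (- ln (cubic_modulus (3 ^ S n * s)) / (3 ^ S n * s)))).
  - intros n. destruct (cubF_modulus_iter s (S n) Hs) as [_ E]. fold b in E.
    specialize (Hz n). pose proof (pow3_ge s (S n) Hs) as Hp.
    assert (H3 : 3 ^ S n <> 0) by (apply pow_nonzero; lra).
    set (u := 3 ^ S n * s) in *. pose proof (eis_theta_ge_1 u ltac:(lra)).
    assert (ln (cubic_modulus u) < 0) by (rewrite <- ln_1; apply ln_increasing; lra).
    replace (cubF (1 - cubic_modulus u)) with (3 ^ S n * b * eis_theta u)
      by (rewrite <- E; field; lra).
    unfold u. unfold u in *. field. repeat split; lra.
  - apply is_lim_seq_mult'; assumption. }
assert (H' : is_lim_seq (fun n => b / s * eis_theta (3 ^ S n * s)) (b / s * 1)).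
{ apply (is_lim_seq_scal_l _ (b / s) 1). exact HA. }
apply is_lim_seq_unique in H. apply is_lim_seq_unique in H'. rewrite H in H'.
injection H' as E. unfold b in E.
replace (cubF (1 - cubic_modulus s))
  with (cubF (1 - cubic_modulus s) / eis_theta s / s * 1 * s * eis_theta s) by (field; lra).
rewrite <- E. ring.
Qed.

(** At this point $F(1-z)=F(z)$, and $F$ is strictly increasing on $[0,1)$, so $1-z=z$. *)
Lemma cubic_modulus_s0 : cubic_modulus s0 = 1 / 2.
Proof.
pose proof s0_ge as Hs. pose proof (cubic_modulus_bound s0 Hs) as Hz.
assert (E : cubF (1 - cubic_modulus s0) = cubF (cubic_modulus s0)).
{ rewrite cubF_modulus_compl, <- eis_theta_hypergeometric by easy.
  assert (0 < sqrt 3) by (apply sqrt_lt_R0; lra). pose proof PI_RGT_0.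
  unfold s0 at 1. field. lra. }
set (z := cubic_modulus s0) in *.
destruct (Rtotal_order (1 - z) z) as [H|[H|H]]; [|lra|].
- pose proof (hypF_incr _ _ _ (1 - z) z hyp_ok_F ltac:(lra) H ltac:(lra)) as Hi.
  fold cubF in Hi. lra.
- pose proof (hypF_incr _ _ _ z (1 - z) hyp_ok_F ltac:(lra) H ltac:(lra)) as Hi.
  fold cubF in Hi. lra.
Qed.

Lemma eis_theta_s0 :
  eis_theta s0 = sqrt 3 / (2 * PI) * (1 / Rpower 2 (1 / 3)) * Beta (1 / 3) (1 / 3).
Proof. rewrite eis_theta_hypergeometric, cubic_modulus_s0 by apply s0_ge. apply cubF_half. Qed.

Lemma cube_lt_compat x y : 0 < x -> x < y -> x ^ 3 < y ^ 3.
Proof.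
intros Hx Hxy. assert (0 < (y - x) * (y * y + y * x + x * x)) by (apply Rmult_lt_0_compat; nra).
simpl. lra.
Qed.

Lemma eis_coset_theta_s0 : eis_coset_theta (s0 / 3) = eis_theta s0 / Rpower 2 (1 / 3).
Proof.
pose proof s0_ge as Hs. pose proof (eis_theta_ge_1 s0 ltac:(lra)) as Ha.
pose proof (eis_coset_theta_pos (s0 / 3) ltac:(lra)) as Hc.
pose proof (cbrt_pos 2) as H2. pose proof (cbrt_cube 2 ltac:(lra)) as H3.
pose proof cubic_modulus_s0 as E. unfold cubic_modulus in E.
change (Rpower 2 (1 / 3)) with (cbrt 2).
set (x := eis_coset_theta (s0 / 3) / eis_theta s0) in *.
assert (Hx : 0 < x) by (apply Rdiv_lt_0_compat; lra).
assert (Hy : 0 < / cbrt 2) by (now apply Rinv_0_lt_compat).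
assert (Ey : (/ cbrt 2) ^ 3 = 1 / 2) by (rewrite pow_inv, H3; field).
assert (Exy : x = / cbrt 2).
{ destruct (Rtotal_order x (/ cbrt 2)) as [H|[H|H]]; [|easy|].
  - pose proof (cube_lt_compat _ _ Hx H). lra.
  - pose proof (cube_lt_compat _ _ Hy H). lra. }
replace (eis_coset_theta (s0 / 3)) with (x * eis_theta s0) by (unfold x; field; lra).
rewrite Exy. field. lra.
Qed.

Theorem theorem5p1 :
  phi tau0 = RtoC (sqrt 3 / (2 * PI) * (1 / Rpower 2 (1 / 3)) * Beta (1 / 3) (1 / 3)) /\
  phi1 tau0 = RtoC (1 / (Rpower 2 (2 / 3) * sqrt 3) * (1 / (2 * PI)) * Beta (1 / 3) (1 / 3)).
Proof.
assert (H3 : 0 < sqrt 3) by (apply sqrt_lt_R0; lra).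
assert (Hq : sqrt 3 * sqrt 3 = 3) by (apply sqrt_sqrt; lra).
pose proof PI_RGT_0 as Hpi.
assert (E0 : phi tau0 = RtoC (eis_theta s0)).
{ unfold tau0. rewrite phi_imaginary by (apply Rdiv_lt_0_compat; lra).
  do 2 f_equal. unfold s0. field. lra. }
assert (E1 : phi (Cdiv tau0 (RtoC 3)) = RtoC (eis_theta (s0 / 3))).
{ replace (Cdiv tau0 (RtoC 3)) with (0, 1 / sqrt 3 / 3).
  - rewrite phi_imaginary by (repeat apply Rdiv_lt_0_compat; lra).
    do 2 f_equal. unfold s0. field. lra.
  - unfold tau0, Cdiv, Cmult, Cinv, RtoC; simpl. f_equal; field; lra. }
rewrite E0. split; [now rewrite eis_theta_s0|].
unfold phi1. rewrite E0, E1, <- RtoC_minus, <- RtoC_mult. f_equal.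
(* The splitting at $s_0/3$ turns the difference of the two values of $\phi$ into twice the coset
   series, so $\phi_1(\tau_0)$ is one third of it. *)
pose proof s0_ge. rewrite (eis_theta_split (s0 / 3)) by lra.
replace (3 * (s0 / 3)) with s0 by field.
rewrite eis_coset_theta_s0, eis_theta_s0.
replace (Rpower 2 (2 / 3)) with (Rpower 2 (1 / 3) * Rpower 2 (1 / 3))
  by (rewrite <- Rpower_plus; f_equal; field).
assert (HP : 0 < Rpower 2 (1 / 3)) by apply exp_pos.
set (P := Rpower 2 (1 / 3)) in *. generalize (Beta (1 / 3) (1 / 3)). intros B.
(* Writing $\sqrt3 = 3/\sqrt3$ cancels the remaining factor $1/3$ and leaves $\sqrt3$ in the
   denominator. *)
replace (sqrt 3 / (2 * PI)) with (3 / (sqrt 3 * (2 * PI))) by (rewrite <- Hq at 1; field; lra).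
field. lra.
Qed.
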